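(* For every convex polyhedron $P\subset\mathbb R^3$ with $E(P)$ edges and $f_2(P)$ facets, \[ 0\le\delta(P)\le M(P):=2E(P)-\frac{f_2(P)}2. \] Moreover, \[ \delta(P)=0\quad\Longleftrightarrow\quad F^*\text{ is a vertex for every facet }F\text{ of }P, \] and \[ \delta(P)=M(P)\quad\Longleftrightarrow\quad P\text{ is facet-paired}. \]
   Context: A convex polyhedron $P\subset\mathbb R^3$ means a compact full-dimensional convex polytope. Two points of $P$ are antipodal if there are two parallel supporting planes of $P$, one through each point, that contain $P$ between them. $V(P)$ is the number of vertices of $P$; $A(P)$ is the number of unordered pairs of distinct vertices of $P$ that are antipodal; $B(P)$ is the number of unordered pairs of distinct edges of $P$ whose midpoints are antipodal. The antipodal defect is $\delta(P)=V(P)-1-A(P)+B(P)$. For $u\in S^2$, $F_P(u)=\{x\in P:\langle u,x\rangle=\max_{y\in P}\langle u,y\rangle\}$. For a facet $F$ with outward unit normal $n_F$, put $F^*=F_P(-n_F)$ (the opposite support face). $P$ is facet-paired if $F^*$ is a facet for every facet $F$ of $P$. *)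

(* Defs.v *)
From HB Require Import structures.
From mathcomp Require Import all_boot all_order all_algebra.
From mathcomp Require Import finmap.
From mathcomp Require Import mathcomp_extra boolp classical_sets functions.
From mathcomp Require Import cardinality reals convex.

Set Implicit Arguments.
Unset Strict Implicit.
Unset Printing Implicit Defensive.

Import Order.TTheory GRing.Theory Num.Theory.
Local Open Scope classical_set_scope.
Local Open Scope ring_scope.

Definition conv_hull (R : realType) (A : set 'rV[R]_3) : set 'rV[R]_3 :=
  smallest (@convex_set R 'rV[R]_3) A.

(* Affine dimension: U is the direction space of the affine hull of A, i.e.
   the smallest linear subspace containing every difference of points of A. *)
Definition has_dim (R : realType) (A : set 'rV[R]_3) (d : nat) : Prop :=
  A !=set0 /\
  exists U : {vspace 'rV[R]_3}, \dim U = d /\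
    forall W : {vspace 'rV[R]_3},
      (U <= W)%VS <-> (forall x y, A x -> A y -> x - y \in W).

Definition convex_polyhedron (R : realType) (P : set 'rV[R]_3) : Prop :=
  (exists2 S : set 'rV[R]_3, finite_set S & P = conv_hull S) /\ has_dim P 3.

Definition dot (R : realType) (u x : 'rV[R]_3) : R := (u *m x^T) 0 0.

Definition sphere (R : realType) : set 'rV[R]_3 := [set u | dot u u = 1].

Definition supp_face (R : realType) (P : set 'rV[R]_3) (u : 'rV[R]_3) :
    set 'rV[R]_3 :=
  [set x | P x /\ forall y, P y -> dot u y <= dot u x].

Definition face (R : realType) (P : set 'rV[R]_3) (d : nat) :
    set (set 'rV[R]_3) :=
  [set F | (exists2 u, sphere u & F = supp_face P u) /\ has_dim F d].

Definition vertex (R : realType) (P : set 'rV[R]_3) : set 'rV[R]_3 :=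
  [set v | face P 0 [set v]].
Definition edge (R : realType) (P : set 'rV[R]_3) : set (set 'rV[R]_3) :=
  face P 1.
Definition facet (R : realType) (P : set 'rV[R]_3) : set (set 'rV[R]_3) :=
  face P 2.

(* The two supporting planes are {z | <u,z> = a} and {z | <u,z> = b}. *)
Definition antipodal (R : realType) (P : set 'rV[R]_3) (x y : 'rV[R]_3) :
    Prop :=
  [/\ P x, P y & exists (u : 'rV[R]_3) (a b : R),
    [/\ u != 0, dot u x = a, dot u y = b &
        forall z, P z -> a <= dot u z <= b]].

Definition is_midpoint (R : realType) (e : set 'rV[R]_3) (m : 'rV[R]_3) :
    Prop :=
  exists a b : 'rV[R]_3, e = conv_hull [set a; b] /\ m = 2^-1 *: (a + b).

Definition antipodal_midpoints (R : realType) (P e f : set 'rV[R]_3) : Prop :=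
  exists m n, [/\ is_midpoint e m, is_midpoint f n & antipodal P m n].

(* Unordered pairs {x, y} of distinct elements of A that are r-related;
   only used for symmetric r. *)
Definition unordered_pairs (T : Type) (A : set T) (r : T -> T -> Prop) :
    set (set T) :=
  [set p | exists x y, [/\ A x, A y, x <> y, r x y & p = [set x; y]]].

(* Number of elements of a finite set (0 on infinite sets; all the sets counted
   below are finite when P is a polytope). *)
Definition card (T : choiceType) (A : set T) : nat := #|` fset_set A|%fset.

Definition nb_vertices (R : realType) (P : set 'rV[R]_3) : nat :=
  card (vertex P).
Definition nb_edges (R : realType) (P : set 'rV[R]_3) : nat := card (edge P).
Definition nb_facets (R : realType) (P : set 'rV[R]_3) : nat := card (facet P).

Definition nb_antipodal_vertices (R : realType) (P : set 'rV[R]_3) : nat :=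
  card (unordered_pairs (vertex P) (antipodal P)).
Definition nb_antipodal_edges (R : realType) (P : set 'rV[R]_3) : nat :=
  card (unordered_pairs (edge P) (antipodal_midpoints P)).

Definition defect (R : realType) (P : set 'rV[R]_3) : int :=
  (nb_vertices P)%:Z - 1 - (nb_antipodal_vertices P)%:Z
    + (nb_antipodal_edges P)%:Z.

Definition max_defect (R : realType) (P : set 'rV[R]_3) : rat :=
  2 * (nb_edges P)%:R - (nb_facets P)%:R / 2.

(* A facet of a full-dimensional polytope has exactly one outward unit normal;
   the default 0 of xget is never used on facets. *)
Definition outward_normal (R : realType) (P F : set 'rV[R]_3) : 'rV[R]_3 :=
  xget 0 [set n | sphere n /\ F = supp_face P n].

Definition opp_face (R : realType) (P F : set 'rV[R]_3) : set 'rV[R]_3 :=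
  supp_face P (- outward_normal P F).

Definition facet_paired (R : realType) (P : set 'rV[R]_3) : Prop :=
  forall F, facet P F -> facet P (opp_face P F).

(* Main.v *)
(* Write F(u) for the face of P in direction u. The cones N(G) = {u : G <= F(u)}
   are closed and convex, and the Euler characteristic extends to a linear
   functional on combinations of indicators of closed convex sets, so every
   pointwise identity between indicators of such cones becomes an identity
   between numbers of nonempty intersections.

   On nonzero u the signed sum over the faces contained in F(u) is 1.
   Integrating this over the sphere gives Euler's formula V - E + f2 = 2, and
   integrating it at -u over N(G) gives, for each face G, the relation
   sum_H (-1)^(dim H) a(G,H) = 1, where a(G,H) says that G and H lie in
   opposite support faces. As 2A and 2B are the sums of a over pairs of
   vertices and pairs of edges, eliminating the mixed sums leaves
     2 delta(P) = sum_F (2 E(F^* ) - [F^* is a facet]),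
   the sum being over facets F and E counting edges, whereas
   2 M(P) = sum_F (2 E(F) - 1) since an edge lies in exactly two facets.
   The first sum vanishes iff every F^* is a vertex; facets whose opposite face
   is a facet contribute equally to both sums, the other ones less to the
   first. *)

Require Import Defs.
From mathcomp Require Import all_boot all_order all_algebra.
From mathcomp Require Import finmap.
From mathcomp Require Import boolp classical_sets.
From mathcomp Require Import cardinality reals convex interval_inference.
From mathcomp Require Import topology normedtype derive.
From mathcomp Require Import lra ring zify.

Set Implicit Arguments.
Unset Strict Implicit.
Unset Printing Implicit Defensive.

Import Order.TTheory GRing.Theory Num.Theory.
Import numFieldNormedType.Exports.
Local Open Scope classical_set_scope.
Local Open Scope ring_scope.

(** * Euler characteristic of closed convex sets *)

(** The minimum of finitely many positive thresholds is positive; this makes one perturbation small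
    enough for a whole list at once. *)
Lemma finite_small (R : realType) (T : eqType) (r : seq T) (Q : T -> R -> Prop) :
  (forall x, x \in r -> exists2 e, 0 < e & forall t, 0 < t <= e -> Q x t) ->
  exists2 e, 0 < e & forall x, x \in r -> forall t, 0 < t <= e -> Q x t.
Proof.
elim: r => [|x r IH] hQ; first by exists 1.
have [e1 e10 h1] := hQ x (mem_head _ _).
have [y yr|e2 e20 h2] := IH; first by apply: hQ; rewrite inE yr orbT.
exists (Num.min e1 e2) => [|y]; first by rewrite lt_min e10 e20.
rewrite inE => /predU1P[->|yr] t /andP[t0]; rewrite le_min => /andP[t1 t2].
  by apply: h1; rewrite t0.
by apply: h2 => //; rewrite t0.
Qed.

(** Induction on the number of surviving terms, removing one nonempty fibre of [f] at a time; [T]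
    may be infinite, as with the real endpoints of intervals. *)
Lemma sum_fibers (I T : eqType) (V : nmodType) (r : seq I) (P : pred I)
    (f : I -> T) (a : I -> V) :
  (forall b, \sum_(i <- r | P i && (f i == b)) a i = 0) ->
  \sum_(i <- r | P i) a i = 0.
Proof.
have [m] := ubnP (count P r).
elim: m P => // m IH P; rewrite ltnS => cP h0.
have [hP|] := boolP (has P r); last first.
  by rewrite has_filter negbK -big_filter => /eqP->; rewrite big_nil.
have [i0 Pi0 i0r] : exists2 i, P i & (count (fun j => P j && (f j == f i)) r > 0)%N.
  elim: r hP {IH cP h0} => //= i r IH; case: (boolP (P i)) => /= [Pi _|Pi /IH[j Pj cj]].
    by exists i; rewrite // eqxx.
  by exists j; rewrite // addn_gt0 cj orbT.
rewrite (bigID (fun i => f i == f i0)) /= h0 add0r; apply: IH => [|b].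
  apply: leq_trans cP.
  have -> : count P r = (count (fun i => P i && (f i == f i0)) r
                + count (fun i => P i && (f i != f i0)) r)%N.
    by elim: (r) => //= j r' ->; case: (P j); case: (f j == f i0) => /=; lia.
  by rewrite -[X in (X < _)%N]add0n ltn_add2r.
have [->|bn] := eqVneq b (f i0).
  by rewrite big_pred0 // => i; case: (f i == f i0); rewrite ?andbF.
rewrite -[RHS](h0 b); apply: eq_bigl => i.
by case: (eqVneq (f i) b) => [->|]; rewrite ?andbF // bn !andbT.
Qed.

Section Intervals.
Variables (R : realType) (I : eqType) (r : seq I) (a : I -> int).
Variables (E : pred I) (l h : I -> R).

(** For small e > 0, an interval contains b + e exactly when it contains b and ends beyond b.
    Subtracting the relation at b + e from the one at b leaves the intervals that end at b, so every
    fibre of [h] sums to zero. *)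
Lemma interval_euler :
  (forall i, E i -> l i <= h i) ->
  (forall s, \sum_(i <- r | E i && (l i <= s <= h i)) a i = 0) ->
  \sum_(i <- r | E i) a i = 0.
Proof.
move=> lh rel; apply: (sum_fibers (f := h)) => b.
(* No left endpoint lies above b and up to b + e, and no right endpoint strictly between b and b +
   e; the halving makes the first bound strict. *)
have [e e0 he] : exists2 e : R, 0 < e & forall i, i \in r -> forall t, 0 < t <= e ->
    (h i <= b \/ b + t <= h i) /\ (l i <= b \/ b + t < l i).
  apply: finite_small => i _; exists (if b < h i then if b < l i then
     Num.min (h i - b) ((l i - b) / 2) else h i - b
     else if b < l i then (l i - b) / 2 else 1).
    by case: ifP => bh; case: ifP => bl; rewrite ?lt_min; lra.
  move=> t; case: ifP => bh; case: ifP => bl; rewrite ?le_min; split; lra.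
have eqr (P Q : pred I) : (forall i, i \in r -> P i = Q i) ->
    \sum_(i <- r | P i) a i = \sum_(i <- r | Q i) a i.
  move=> PQ; rewrite big_seq_cond [RHS]big_seq_cond; apply: eq_bigl => i.
  by case: (boolP (i \in r)) => //= /PQ.
have := rel b; rewrite (bigID (fun i => h i == b)) /=.
rewrite [X in _ + X](_ : _ = 0); last first.
  rewrite -[RHS](rel (b + e)); apply: eqr => i ir; case Ei: (E i) => //=.
  have [] := he i ir e; first by rewrite e0 lexx.
  by case=> ?; case=> ?; have := lh i Ei; lra.
rewrite addr0 => R1; rewrite -[RHS]R1; apply: eqr => i ir; case Ei: (E i) => //=.
by have := lh i Ei; lra.
Qed.
End Intervals.

(** Convexity with a plain real weight, against the bundled interval element of [convex_set];
    [convex_set_cvx] relates the two. *)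
Definition cvx (R : realType) (V : lmodType R) (A : set V) :=
  forall x y t, A x -> A y -> 0 <= t <= 1 -> A (t *: x + (1 - t) *: y).

Lemma cvxI (R : realType) (V : lmodType R) (A B : set V) :
  cvx A -> cvx B -> cvx (A `&` B).
Proof. by move=> cA cB x y t [Ax Bx] [Ay By] t01; split; [exact: cA|exact: cB]. Qed.

(** The extreme values are attained by compactness, and convexity fills in all values between
    them. *)
Lemma coord_image_segment (R : realType) n (K : set 'rV[R]_n) (j : 'I_n) :
  compact K -> cvx K -> K !=set0 ->
  exists lh : R * R, lh.1 <= lh.2 /\
    forall s, (exists2 u, K u & u 0 j = s) <-> lh.1 <= s <= lh.2.
Proof.
move=> cK vK K0.
have cj : {within K, continuous (fun u : 'rV[R]_n => u 0 j)}.
  exact/continuous_subspaceT/coord_continuous.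
have [x /set_mem Kx hx] := EVT_max_rV K0 cK cj.
have [y /set_mem Ky hy] := EVT_min_rV K0 cK cj.
exists (y 0 j, x 0 j) => /=; split; first by apply: hx; apply/mem_set.
move=> s; split=> [[u Ku <-]|/andP[ys sx]].
  by rewrite hx ?hy //; apply/mem_set.
have [e|ne] := eqVneq (y 0 j) (x 0 j); first by exists x => //; lra.
have d0 : 0 < x 0 j - y 0 j by lra.
exists (((s - y 0 j) / (x 0 j - y 0 j)) *: x + (1 - (s - y 0 j) / (x 0 j - y 0 j)) *: y).
  by apply: vK => //; rewrite divr_ge0 ?ler_pdivrMr //=; lra.
by rewrite !mxE; field; lra.
Qed.

(* Induction on the number of free coordinates: slicing along a coordinate reduces
   the identity to segments of the line. *)
Lemma compact_euler (R : realType) n (I : eqType) (r : seq I) (a : I -> int)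
    (K : I -> set 'rV[R]_n) :
  (forall i, compact (K i)) -> (forall i, cvx (K i)) ->
  (forall u, \sum_(i <- r | `[< K i u >]) a i = 0) ->
  \sum_(i <- r | `[< K i !=set0 >]) a i = 0.
Proof.
(* Coordinates from [m] on are frozen to those of [p], so [m] counts the free ones and m = n is the
   full claim. *)
suff H m (p : 'rV[R]_n) (L : I -> set 'rV[R]_n) :
    (forall i, compact (L i)) -> (forall i, cvx (L i)) ->
    (forall i u, L i u -> forall j : 'I_n, (m <= j)%N -> u 0 j = p 0 j) ->
    (forall u, \sum_(i <- r | `[< L i u >]) a i = 0) ->
    \sum_(i <- r | `[< L i !=set0 >]) a i = 0.
  by move=> cK vK; apply: (H n (0 : 'rV[R]_n) K cK vK) => i u _ j; rewrite leqNgt ltn_ord.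
elim: m p L => [|m IH] p L cL vL hL rel.
  rewrite -[RHS](rel p); apply: eq_bigl => i; apply/asbool_equiv_eq.
  split=> [[u Lu]|Lp]; last by exists p.
  suff <- : u = p by [].
  by apply/rowP => j; apply: hL Lu _ _.
have [nm|mn] := leqP n m.
  by apply: (IH p) => // i u _ j /(leq_trans nm); rewrite leqNgt ltn_ord.
pose j0 := Ordinal mn.
have /choice[lh hlh] : forall i, exists lh : R * R, L i !=set0 -> lh.1 <= lh.2 /\
    forall s, (exists2 u, L i u & u 0 j0 = s) <-> lh.1 <= s <= lh.2.
  move=> i; have [Li|Li] := pselect (L i !=set0); last by exists (0, 0).
  by have [lh hlh] := coord_image_segment j0 (cL i) (vL i) Li; exists lh.
apply: (interval_euler (l := fun i => (lh i).1) (h := fun i => (lh i).2)).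
  by move=> i /asboolP/hlh[].
move=> s.
(* Slices at height s have one free coordinate fewer, and a slice is nonempty exactly when s lies in
   the segment [lh i]. *)
have S0 : \sum_(i <- r | `[< (L i `&` [set u | u 0 j0 = s]) !=set0 >]) a i = 0.
  apply: (IH (\row_j if j == j0 then s else p 0 j)).
  - move=> i; apply: compact_closedI => //.
    by apply: preimage_closed (@closed_eq _ s) => u _; exact: coord_continuous.
  - move=> i; apply: cvxI => // x y t /= xs ys _; rewrite !mxE xs ys; ring.
  - move=> i u /= [Lu us] j mj; rewrite mxE; case: eqP => [->//|jn].
    apply: hL Lu _ _; rewrite ltn_neqAle mj andbT; apply/eqP => e.
    by apply: jn; apply/val_inj.
  - move=> u; have [us|us] := pselect (u 0 j0 = s); last first.
      by rewrite big_pred0 // => i; apply/asboolP => -[].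
    rewrite -[RHS](rel u); apply: eq_bigl => i; apply/asbool_equiv_eq.
    by split=> [[]|].
rewrite -[RHS]S0; apply: eq_bigl => i; apply/andP/asboolP.
  move=> [/asboolP Li lsh]; have [_ /(_ s)[_ /(_ lsh) [u Lu us]]] := hlh i Li.
  by exists u.
move=> [u [Lu us]]; have Li : L i !=set0 by exists u.
by split; [exact/asboolP|have [_ /(_ s)[-> //]] := hlh i Li; exists u].
Qed.

Lemma norm_seq_bound (R : realType) n (T : eqType) (s : seq T) (p : T -> 'rV[R]_n) :
  exists M : R, forall x, x \in s -> `|p x| <= M.
Proof.
elim: s => [|x s [M hM]]; first by exists 0.
exists (Num.max `|p x| M) => y; rewrite inE le_max => /predU1P[->|/hM->].
  by rewrite lexx.
by rewrite orbT.
Qed.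

(** Reduction to [compact_euler]: a large ball that holds a point of [K0] and one of each nonempty
    intersection makes all sets compact, and the set [K0] itself, entered as index [None] with
    coefficient -1, turns the value 1 into a relation with value 0. *)
Lemma euler_one (R : realType) n (I : eqType) (r : seq I) (a : I -> int)
    (K : I -> set 'rV[R]_n) (K0 : set 'rV[R]_n) :
  (forall i, closed (K i)) -> (forall i, cvx (K i)) ->
  closed K0 -> cvx K0 -> K0 !=set0 ->
  (forall u, K0 u -> \sum_(i <- r | `[< K i u >]) a i = 1) ->
  \sum_(i <- r | `[< (K i `&` K0) !=set0 >]) a i = 1.
Proof.
move=> cK vK cK0 vK0 [p0 K0p0] rel.
have /choice[p hp] : forall i, exists p, (K i `&` K0) !=set0 -> (K i `&` K0) p.
  by move=> i; have [[q Kq]|Ki] := pselect ((K i `&` K0) !=set0);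
    [exists q | exists 0].
have [M hM] := norm_seq_bound r p.
pose B := [set u : 'rV[R]_n | `|u| <= Num.max `|p0| M].
have cB : closed B.
  by apply: preimage_closed (@closed_le _ _) => u _; exact: norm_continuous.
have vB : cvx B.
  move=> x y t xB yB /andP[t0 t1]; apply: le_trans (ler_normD _ _) _.
  rewrite !normrZ (ger0_norm t0) (ger0_norm (_ : 0 <= 1 - t)) ?subr_ge0 //.
  rewrite -[leRHS](_ : t * Num.max `|p0| M + (1 - t) * Num.max `|p0| M = _).
    by rewrite lerD // ler_wpM2l // subr_ge0.
  by rewrite -mulrDl addrC subrK mul1r.
have kB : compact B.
  apply: bounded_closed_compact => //.
  exists (Num.max `|p0| M); split; first exact: num_real.
  by move=> e eM u Bu; apply: le_trans Bu (ltW eM).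
pose L o := B `&` if o is Some i then K i `&` K0 else K0.
have := @compact_euler R n (option I) (None :: map Some r)
  (fun o => if o is Some i then a i else -1) L.
rewrite big_cons big_map ifT; last first.
  by apply/asboolP; exists p0; split; rewrite //= /B /= le_max lexx.
move=> H; have {H} : -1 + \sum_(j <- r | `[< L (Some j) !=set0 >]) a j = 0.
  apply: H.
  - by move=> [i|]; apply: compact_closedI => //; exact: closedI.
  - by move=> [i|]; apply: cvxI => //; exact: cvxI.
  move=> u; rewrite big_cons big_map.
  have [Bu|nBu] := pselect (L None u); last first.
    rewrite ifF; last exact/asboolP.
    by apply: big_pred0 => i; apply/asboolP => -[? [? ?]]; apply: nBu; split.
  rewrite ifT; last exact/asboolP.
  case: Bu => Bu K0u; apply/eqP; rewrite addrC subr_eq0; apply/eqP.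
  rewrite -[RHS](rel u) //; apply: eq_bigl => i; apply/asbool_equiv_eq.
  by split=> [[_ []]|].
move/eqP; rewrite addrC subr_eq0 => /eqP S1; rewrite -[RHS]S1.
rewrite big_seq_cond [RHS]big_seq_cond; apply: eq_bigl => i.
case: (boolP (i \in r)) => //= ir; apply/asbool_equiv_eq.
split=> [/hp Kp|[u [_ ?]]]; last by exists u.
by exists (p i); split=> //; rewrite /B /= le_max hM ?orbT.
Qed.

(** * The inner product on row vectors *)

Definition ip (R : realType) n (w u : 'rV[R]_n) : R := (w *m u^T) 0 0.

Section InnerProduct.
Variables (R : realType) (n : nat).
Implicit Types u v w : 'rV[R]_n.

Lemma ipE w u : ip w u = \sum_j w 0 j * u 0 j.
Proof. by rewrite /ip mxE; apply: eq_bigr => j _; rewrite mxE. Qed.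

Lemma ipC w u : ip w u = ip u w.
Proof. by rewrite !ipE; apply: eq_bigr => j _; rewrite mulrC. Qed.

Lemma ipDr w u v : ip w (u + v) = ip w u + ip w v.
Proof. by rewrite /ip linearD /= mulmxDr mxE. Qed.

Lemma ipZr w t u : ip w (t *: u) = t * ip w u.
Proof. by rewrite /ip linearZ /= -scalemxAr mxE. Qed.

Lemma ipNr w u : ip w (- u) = - ip w u.
Proof. by rewrite -scaleN1r ipZr mulN1r. Qed.

Lemma ipBr w u v : ip w (u - v) = ip w u - ip w v.
Proof. by rewrite ipDr ipNr. Qed.

Lemma ip0r w : ip w 0 = 0.
Proof. by rewrite -[0](scale0r 0) ipZr mul0r. Qed.

Lemma ipDl w u v : ip (u + v) w = ip u w + ip v w.
Proof. by rewrite !(ipC _ w) ipDr. Qed.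

Lemma ipZl w t u : ip (t *: u) w = t * ip u w.
Proof. by rewrite !(ipC _ w) ipZr. Qed.

Lemma ipNl w u : ip (- u) w = - ip u w.
Proof. by rewrite !(ipC _ w) ipNr. Qed.

Lemma ipBl w u v : ip (u - v) w = ip u w - ip v w.
Proof. by rewrite ipDl ipNl. Qed.

Lemma ip0l w : ip 0 w = 0.
Proof. by rewrite ipC ip0r. Qed.

Lemma ip_suml w (T : Type) (s : seq T) (f : T -> 'rV[R]_n) :
  ip (\sum_(x <- s) f x) w = \sum_(x <- s) ip (f x) w.
Proof. by elim/big_rec2: _ => [|x y z _ <-]; rewrite ?ip0l // ipDl. Qed.

Lemma ip_ge0 u : 0 <= ip u u.
Proof. by rewrite ipE sumr_ge0 // => j _; rewrite -expr2 sqr_ge0. Qed.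

Lemma ip_eq0 u : (ip u u == 0) = (u == 0).
Proof.
apply/eqP/eqP => [|->]; last exact: ip0l.
rewrite ipE => /eqP; rewrite psumr_eq0 => [/allP h|j _]; last by rewrite -expr2 sqr_ge0.
apply/rowP => j; rewrite mxE; apply/eqP.
by have := h j (mem_index_enum _); rewrite /= mulf_eq0 orbb.
Qed.

Lemma ip_eq1_neq0 w u : ip w u = 1 -> u != 0.
Proof.
by move=> wu; apply/eqP => u0; move: wu; rewrite u0 ip0r => /eqP; rewrite eq_sym oner_eq0.
Qed.

Lemma ip_continuous w : continuous (ip w).
Proof.
have -> : ip w = fun u => \sum_j w 0 j * u 0 j by apply/funext => u; rewrite ipE.
apply: continuous_big => [|j _ u]; first exact: add_continuous.
by apply: continuousM; [exact: cst_continuous|exact: coord_continuous].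
Qed.

Lemma closed_ip_ge w c : closed [set u | c <= ip w u].
Proof. by apply: preimage_closed (@closed_ge _ c) => u _; exact: ip_continuous. Qed.

Lemma closed_ip_eq w c : closed [set u | ip w u = c].
Proof. by apply: preimage_closed (@closed_eq _ c) => u _; exact: ip_continuous. Qed.

Lemma cvx_ip_ge w c : cvx [set u | c <= ip w u].
Proof.
move=> x y t /= cx cy /andP[t0 t1]; rewrite ipDr !ipZr.
have := ler_wpM2l t0 cx; have := ler_wpM2l (_ : 0 <= 1 - t) cy; rewrite ?subr_ge0 //; lra.
Qed.

Lemma cvx_ip_eq w c : cvx [set u | ip w u = c].
Proof. by move=> x y t /= cx cy _; rewrite ipDr !ipZr cx cy; lra. Qed.

End InnerProduct.

(** * Pointed cones *)

Section Orthants.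
Variables (R : realType) (n : nat).
Implicit Types (u : 'rV[R]_n) (s : {ffun 'I_n -> option bool}).

(** The three values of [option bool] encode two closed half-lines and the origin; a function from
    coordinates to them encodes a closed cell of the orthant fan. *)
Definition sign_ok (o : option bool) (x : R) :=
  match o with Some true => 0 <= x | Some false => x <= 0 | None => x == 0 end.

Definition orthant s u := [forall j, sign_ok (s j) (u 0 j)].

Definition orthant_axis s : 'rV[R]_n :=
  \row_j (match s j with Some true => 1 | Some false => -1 | None => 0 end).

(** (-1) to the codimension of the cell, the coefficient with which the indicators of the closed
    cells add up to 1. *)
Definition orthant_sign s : int := \prod_j (if s j is Some _ then 1 else -1).

Let s0 : {ffun 'I_n -> option bool} := [ffun=> None].

Lemma sum_option_bool (V : nmodType) (F : option bool -> V) :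
  \sum_o F o = F None + (F (Some true) + F (Some false)).
Proof.
rewrite (bigD1 None) // (bigD1 (Some true)) // (bigD1 (Some false)) //= big_pred0 ?addr0 //.
by case=> [[]|].
Qed.

(** The sum factors over the coordinates, where [x >= 0] + [x <= 0] - [x = 0] = 1. *)
Lemma orthant_inclusion_exclusion u : \sum_(s | orthant s u) orthant_sign s = 1.
Proof.
pose c (o : option bool) : int := if o is Some _ then 1 else -1.
have -> : \sum_(s | orthant s u) orthant_sign s =
    \sum_(s : {ffun _ -> _}) \prod_j (if sign_ok (s j) (u 0 j) then c (s j) else 0).
  rewrite big_mkcond; apply: eq_bigr => s _; rewrite /orthant.
  case: forallP => [h|/forallP].
    by apply: eq_bigr => j _; rewrite h.
  by rewrite negb_forall => /existsP[j /negbTE hj]; rewrite (bigD1 j) //= hj mul0r.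
rewrite -(bigA_distr_bigA (fun j o => if sign_ok o (u 0 j) then c o else 0)).
apply: big1 => j _; rewrite sum_option_bool /=.
by case: (ltrgt0P (u 0 j)).
Qed.

(** All the signs together give (1 + 1 - 1)^n = 1, of which the origin cell contributes (-1)^n. *)
Lemma sum_orthant_sign :
  \sum_(s | s != s0) orthant_sign s = 1 - (-1) ^+ n.
Proof.
have : \sum_(s : {ffun _ -> _}) orthant_sign s = 1.
  rewrite -(bigA_distr_bigA (fun j (o : option bool) => if o is Some _ then 1 else -1)).
  by apply: big1 => j _; rewrite sum_option_bool.
rewrite (bigD1 s0) //=.
have -> : orthant_sign s0 = (-1) ^+ n.
  rewrite /orthant_sign (eq_bigr (fun=> -1)) => [|j _]; last by rewrite ffunE.
  by rewrite prodr_const card_ord.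
by move=> /(canRL (addKr _)) ->; rewrite addrC.
Qed.

Lemma orthant0 u : orthant s0 u = (u == 0).
Proof.
apply/forallP/eqP => [h|-> j]; last by rewrite ffunE mxE /=.
by apply/rowP => j; have := h j; rewrite ffunE mxE => /eqP.
Qed.

(** On its own cell the form is the sum of the absolute values of the coordinates. *)
Lemma orthant_axis_gt0 s u : orthant s u -> u != 0 -> 0 < ip (orthant_axis s) u.
Proof.
move=> /forallP h; apply: contra_neqT; rewrite -leNgt => le0.
have t0 j : 0 <= orthant_axis s 0 j * u 0 j.
  by have := h j; rewrite mxE; case: (s j) => [[]|] /=; lra.
move: le0; rewrite ipE le_eqVlt ltNge sumr_ge0 ?orbF => [|j _]; last exact: t0.
rewrite psumr_eq0 => [/allP z|j _]; last exact: t0.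
apply/rowP => j; have := z j (mem_index_enum _); have := h j; rewrite !mxE /=.
case: (s j) => [[]|] /=; rewrite ?mul1r ?mulN1r ?oppr_eq0 => ? /eqP //.
by move=> _; apply/eqP.
Qed.

Lemma orthant_axisP s : s != s0 -> exists2 u, orthant s u & ip (orthant_axis s) u = 1.
Proof.
move=> ss; pose x := orthant_axis s.
have ox : orthant s x.
  by apply/forallP => j; rewrite mxE; case: (s j) => [[]|] //=; lra.
have x0 : x != 0.
  apply: contra ss => /eqP x0; apply/eqP/ffunP => j; rewrite ffunE.
  have : x 0 j = 0 by rewrite x0 mxE.
  by rewrite mxE; case: (s j) => [[]|] // /eqP; rewrite ?oppr_eq0 oner_eq0.
have p := orthant_axis_gt0 ox x0.
exists ((ip x x)^-1 *: x); last by rewrite ipZr mulVf // gt_eqF.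
apply/forallP => j; rewrite mxE; have /forallP/(_ j) := ox.
have q : 0 < (ip x x)^-1 by rewrite invr_gt0.
case: (s j) => [[]|] /=; rewrite ?pmulr_rge0 ?pmulr_rle0 // => /eqP ->.
by rewrite mulr0.
Qed.

Lemma closed_orthant s : closed [set u | orthant s u].
Proof.
have -> : [set u | orthant s u] = \bigcap_j [set u : 'rV[R]_n | sign_ok (s j) (u 0 j)].
  apply/seteqP; split => u /=; first by move=> /forallP h j _; exact: h.
  by move=> h; apply/forallP => j; exact: h.
apply: closed_bigI => j _.
have cj := @coord_continuous R 1 n 0 j.
case: (s j) => [[]|] /=.
- by apply: preimage_closed (@closed_ge _ 0) => u _; apply: cj.
- by apply: preimage_closed (@closed_le _ 0) => u _; apply: cj.
- rewrite (_ : [set u | _] = [set u : 'rV[R]_n | u 0 j = 0]).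
    by apply: preimage_closed (@closed_eq _ 0) => u _; apply: cj.
  by apply/seteqP; split => u /= /eqP.
Qed.

Lemma cvx_orthant s : cvx [set u | orthant s u].
Proof.
move=> x y t /forallP xs /forallP ys /andP[t0 t1]; apply/forallP => j.
have := xs j; have := ys j; rewrite !mxE; case: (s j) => [[]|] /=; nra.
Qed.

(* The Euler characteristic of the sphere, computed on the orthant fan: both a
   pointed cone and a closed orthant have a compact convex base, where
   [euler_one] applies. *)
Lemma sphere_euler (I : eqType) (r : seq I) (a : I -> int)
    (C : I -> set 'rV[R]_n) (w : I -> 'rV[R]_n) :
  (forall i, closed (C i)) -> (forall i, cvx (C i)) ->
  (forall i u (t : R), C i u -> 0 <= t -> C i (t *: u)) ->
  (forall i u, i \in r -> C i u -> u != 0 -> 0 < ip (w i) u) ->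
  (forall u, u != 0 -> \sum_(i <- r | `[< C i u >]) a i = 1) ->
  \sum_(i <- r | `[< exists2 u : 'rV[R]_n, u != 0 & C i u >]) a i = 1 - (-1) ^+ n.
Proof.
move=> cC vC kC wC rel.
pose hit i s := `[< exists u, [/\ u != 0, C i u & orthant s u] >].
(* Scaling moves a nonzero point of a cone into its base, the slice where the form [v] equals 1. *)
have normalize (A : set 'rV[R]_n) v : (forall u (t : R), A u -> 0 <= t -> A (t *: u)) ->
    (forall u, A u -> u != 0 -> 0 < ip v u) ->
    (exists2 u : 'rV[R]_n, u != 0 & A u) <-> exists2 u, A u & ip v u = 1.
  move=> kA pA; split=> [[u u0 Au]|[u Au v1]]; last first.
    by exists u => //; apply: ip_eq1_neq0 v1.
  have p := pA u Au u0; exists ((ip v u)^-1 *: u).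
    by apply: kA => //; rewrite invr_ge0 ltW.
  by rewrite ipZr mulVf // gt_eqF.
have ko s u (t : R) : orthant s u -> 0 <= t -> orthant s (t *: u).
  move=> /forallP h t0; apply/forallP => j; have := h j; rewrite mxE.
  by case: (s j) => [[]|] /=; try nra; move/eqP->; rewrite mulr0.
(* The base of a cell is [K0] here; its points are nonzero, so the hypothesis on the cones [C i]
   gives the value 1. *)
have link s : s != s0 -> \sum_(i <- r | hit i s) a i = 1.
  move=> ss; pose K0 := [set u | orthant s u] `&` [set u | ip (orthant_axis s) u = 1].
  have := @euler_one R n I r a C K0 cC vC _ _ _ _.
  have K00 : K0 !=set0 by have [u ? ?] := orthant_axisP ss; exists u.
  have cK0 : closed K0 by apply: closedI; [exact: closed_orthant|exact: closed_ip_eq].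
  have vK0 : cvx K0 by apply: cvxI; [exact: cvx_orthant|exact: cvx_ip_eq].
  move=> /(_ cK0 vK0 K00) <- => [|u [_ u1]]; last first.
    by apply: rel; apply: ip_eq1_neq0 u1.
  apply: eq_bigl => i; apply/asbool_equiv_eq.
  have [|u [_ ou]|h1 h2] := normalize (C i `&` [set u | orthant s u]) (orthant_axis s).
  - by move=> u t [Cu ou] t0; split; [exact: kC|exact: ko].
  - exact: orthant_axis_gt0.
  split=> [[u [u0 Cu ou]]|[u [Cu [ou u1]]]].
    by have [|v [Cv ov] v1] := h1; [exists u | exists v].
  by have [|v v0 [Cv ov]] := h2; [exists u | exists v].
(* The roles are exchanged: the base of [C i] is [K0], and the orthant cells provide the value 1. *)
have dual i : i \in r -> (exists2 u : 'rV[R]_n, u != 0 & C i u) ->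
    \sum_(s | (s != s0) && hit i s) orthant_sign s = 1.
  move=> ir Ci; pose K0 := C i `&` [set u | ip (w i) u = 1].
  have := @euler_one R n _ (index_enum _) orthant_sign (fun s => [set u | orthant s u]) K0
    closed_orthant cvx_orthant _ _ _ _.
  have nz := @normalize (C i) (w i) (kC i) (fun u => wC i u ir).
  have K00 : K0 !=set0 by have [h _] := nz; have [u ? ?] := h Ci; exists u.
  have cK0 : closed K0 by apply: closedI => //; exact: closed_ip_eq.
  have vK0 : cvx K0 by apply: cvxI => //; exact: cvx_ip_eq.
  move=> /(_ cK0 vK0 K00) <- => [|u _]; last first.
    rewrite -[RHS](orthant_inclusion_exclusion u); apply: eq_bigl => s.
    exact: asboolb.
  apply: eq_bigl => s; apply/andP/asboolP => [[_ /asboolP[u [u0 Cu ou]]]|[u [ou [Cu u1]]]].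
    have p := wC i u ir Cu u0; have p' : 0 <= (ip (w i) u)^-1 by rewrite invr_ge0 ltW.
    exists ((ip (w i) u)^-1 *: u); split; first exact: ko.
    by split; [exact: kC | rewrite /= ipZr mulVf // gt_eqF].
  have u0 : u != 0 := ip_eq1_neq0 u1.
  split; last by apply/asboolP; exists u.
  by apply: contra u0 => /eqP ss; rewrite -orthant0 -ss.
(* Pairs (i, s) that meet outside the origin are counted twice with weight a i times the sign of s:
   summing over s first gives the left side by [dual], over i first the right side by [link]. *)
rewrite -sum_orthant_sign.
transitivity (\sum_(i <- r) \sum_(s | (s != s0) && hit i s) a i * orthant_sign s).
  rewrite big_mkcond big_seq [RHS]big_seq; apply: eq_bigr => i ir.
  rewrite -big_distrr /=; case: asboolP => [Ci|nCi].
    by rewrite dual // mulr1.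
  rewrite big_pred0 ?mulr0 // => s; apply/negP => /andP[_ /asboolP[u [u0 Cu _]]].
  by apply: nCi; exists u.
rewrite (exchange_big_dep (fun s => s != s0)) /= => [|i s _ /andP[]//].
apply: eq_bigr => s ss; rewrite -big_distrl /= (eq_bigl (fun i => hit i s)).
  by rewrite link // mul1r.
by move=> i; rewrite ss.
Qed.

End Orthants.

(** * Support faces of a polytope *)

Section Hulls.
Variable R : realType.
Implicit Types (A B : set 'rV[R]_3) (s : seq 'rV[R]_3).

Lemma convex_set_cvx (A : set 'rV[R]_3) : @convex_set R 'rV[R]_3 A <-> cvx A.
Proof.
split=> [cA x y t Ax Ay /andP[t0 t1]|cA x y l /set_mem Ax /set_mem Ay].
  have := cA x y (Itv01 t0 t1) (mem_set Ax) (mem_set Ay).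
  by move=> /set_mem.
by apply/mem_set; apply: cA => //; apply/andP; split; [exact: ge0|exact: le1].
Qed.

Lemma sub_conv_hull A : A `<=` conv_hull A.
Proof. exact: sub_gen_smallest. Qed.

Lemma conv_hull_min A B : cvx B -> A `<=` B -> conv_hull A `<=` B.
Proof. by move=> /convex_set_cvx; exact: smallest_sub. Qed.

Lemma cvx_conv_hull A : cvx (conv_hull A).
Proof.
move=> x y t hx hy t01 B [cB AB]; have /convex_set_cvx vB := cB.
by apply: vB => //; [exact: (hx B)|exact: (hy B)].
Qed.

Lemma conv_hullS A B : A `<=` B -> conv_hull A `<=` conv_hull B.
Proof.
move=> AB; apply: conv_hull_min; first exact: cvx_conv_hull.
exact: subset_trans AB (@sub_conv_hull B).
Qed.

Lemma cvx_ip_le n (w : 'rV[R]_n) c : cvx [set u | ip w u <= c].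
Proof.
have := @cvx_ip_ge R n (- w) (- c); congr (cvx _).
by apply/seteqP; split => u /=; rewrite ipNl lerN2.
Qed.

Lemma conv_hull_ip_le A u c :
  (forall x, A x -> ip u x <= c) -> forall x, conv_hull A x -> ip u x <= c.
Proof. by move=> h; apply: conv_hull_min; [exact: cvx_ip_le|]. Qed.

Lemma conv_hull_ip_eq A u c :
  (forall x, A x -> ip u x = c) -> forall x, conv_hull A x -> ip u x = c.
Proof. by move=> h; apply: conv_hull_min; [exact: cvx_ip_eq|]. Qed.

(** Generators form a list, so that a support face is the hull of a filtered list. *)
Definition hull s := conv_hull [set x | x \in s].

Lemma mem_hull s x : x \in s -> hull s x.
Proof. exact: sub_conv_hull. Qed.

Lemma hull_nonempty s : hull s !=set0 -> s != [::].
Proof.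
case=> x hx; apply/eqP => s0; move: hx; rewrite s0.
by apply: (@conv_hull_min _ set0) => // y.
Qed.

Lemma seq_max (T : eqType) (f : T -> R) (s : seq T) : s != [::] ->
  exists2 x, x \in s & forall y, y \in s -> f y <= f x.
Proof.
elim: s => // x s IH _; have [->|/IH[z zs hz]] := eqVneq s [::].
  by exists x; rewrite ?mem_head // => y; rewrite inE => /eqP->.
have [xz|zx] := lerP (f x) (f z).
  exists z; first by rewrite inE zs orbT.
  by move=> y; rewrite inE => /predU1P[->|/hz].
exists x; rewrite ?mem_head // => y; rewrite inE => /predU1P[->//|/hz yz].
by apply: le_trans yz (ltW zx).
Qed.

(** [dot] is convertible with [ip] in dimension 3. *)
Lemma supp_faceP A u x : supp_face A u x <-> A x /\ forall y, A y -> ip u y <= ip u x.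
Proof. by []. Qed.

Lemma cvx_supp_face A u : cvx A -> cvx (supp_face A u).
Proof.
move=> cA x y t /supp_faceP[Ax mx] /supp_faceP[Ay my] t01; apply/supp_faceP.
split=> [|z Az]; first exact: cA.
rewrite ipDr !ipZr; have := mx z Az; have := my z Az; case/andP: t01; nra.
Qed.

(* The points that lie in the hull of the maximisers or strictly below the
   maximum form a convex set containing every generator. *)
Lemma supp_face_hull s u :
  supp_face (hull s) u = hull [seq x <- s | `[< supp_face (hull s) u x >]].
Proof.
set s' := [seq x <- s | _].
have HF : hull s' `<=` supp_face (hull s) u.
  apply: conv_hull_min; first by apply: cvx_supp_face; exact: cvx_conv_hull.
  by move=> x /=; rewrite mem_filter => /andP[/asboolP].
apply/seteqP; split=> // x Fx; have /supp_faceP[hx mx] := Fx.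
have HE y : hull s' y -> ip u y = ip u x.
  move=> /HF/supp_faceP[hy my]; apply/eqP; rewrite eq_le; apply/andP.
  by split; [exact: mx | exact: my].
have : [set y | ip u y <= ip u x /\ (hull s' y \/ ip u y < ip u x)] x.
  move: hx; apply: conv_hull_min => [y z t [ly ky] [lz kz] /andP[t0 t1]|y ys] /=.
    split; first by rewrite ipDr !ipZr; nra.
    have [->|tn0] := eqVneq t 0; first by rewrite scale0r add0r subr0 scale1r.
    have [->|tn1] := eqVneq t 1; first by rewrite scale1r subrr scale0r addr0.
    have tp : 0 < t by rewrite lt_neqAle eq_sym tn0.
    have t1p : t < 1 by rewrite lt_neqAle tn1.
    case: ky kz => [ky [kz|kz]|ky _].
    - by left; apply: cvx_conv_hull => //; rewrite t0.
    - by right; rewrite ipDr !ipZr (HE y ky); nra.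
    - by right; rewrite ipDr !ipZr; nra.
  have ly := mx y (mem_hull ys); split=> //.
  have [yx|yx] := ltrP (ip u y) (ip u x); [by right|left].
  apply: mem_hull; rewrite mem_filter ys andbT; apply/asboolP/supp_faceP.
  by split=> [|z /mx zx]; [exact: mem_hull | exact: le_trans zx yx].
by case=> _ []; rewrite ?ltxx.
Qed.

Lemma supp_face_hullP s u x :
  supp_face (hull s) u x <-> hull s x /\ forall y, y \in s -> ip u y <= ip u x.
Proof.
split=> [/supp_faceP[hx mx]|[hx mx]]; last first.
  by apply/supp_faceP; split=> // y; apply: conv_hull_ip_le.
by split=> // y /mem_hull; exact: mx.
Qed.

Lemma supp_face_nonempty s u : hull s !=set0 -> exists2 x, x \in s & supp_face (hull s) u x.
Proof.
move=> /hull_nonempty/(seq_max (ip u))[x xs mx]; exists x => //.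
by apply/supp_face_hullP; split=> //; exact: mem_hull.
Qed.

Lemma supp_face0 A : supp_face A 0 = A.
Proof.
apply/seteqP; split=> [x [] //|x Ax]; apply/supp_faceP; split=> // y _.
by rewrite !ip0l.
Qed.

(** A slight tilt of [n] towards [d] maximises [n] first and breaks ties by [d]: for small e,
    generators below the maximum of [n] stay below. *)
Lemma supp_face_tilt s n d : hull s !=set0 ->
  exists2 e, 0 < e & supp_face (hull s) (n + e *: d) = supp_face (supp_face (hull s) n) d.
Proof.
move=> s0; have [x0 x0s Fx0] : exists2 x, x \in s & supp_face (supp_face (hull s) n) d x.
  rewrite (supp_face_hull s n).
  have [|x xs ?] := @supp_face_nonempty [seq x <- s | `[< supp_face (hull s) n x >]] d.
    by rewrite -supp_face_hull; have [x _ Fx] := supp_face_nonempty n s0; exists x.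
  by exists x => //; move: xs; rewrite mem_filter => /andP[].
have /supp_faceP[/supp_face_hullP[hx0 nx0] dx0] := Fx0.
have [e e0 he] : exists2 e, 0 < e & forall y, y \in s -> forall t, 0 < t <= e ->
    ip n y < ip n x0 -> ip (n + t *: d) y < ip (n + t *: d) x0.
  apply: finite_small => y ys; have [lt|] := boolP (ip n y < ip n x0); last first.
    by exists 1.
  (* The deficit of y in [n] over a bound for its possible gain in [d]; the added 1 keeps the
     divisor positive. *)
  exists ((ip n x0 - ip n y) / (1 + `|ip d y - ip d x0|)).
    by rewrite divr_gt0 ?subr_gt0 // ltr_pwDl.
  move=> t /andP[t0 te] _; rewrite !ipDl !ipZl.
  have D0 : 0 < 1 + `|ip d y - ip d x0| by rewrite ltr_pwDl.
  move: te; rewrite ler_pdivlMr // => te; have := ler_norm (ip d y - ip d x0).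
  nra.
exists e => //; have ee : 0 < e <= e by rewrite e0 lexx.
have le y : y \in s -> ip (n + e *: d) y <= ip (n + e *: d) x0.
  move=> ys; have [/(he y ys e ee)/ltW //|ge] := ltrP (ip n y) (ip n x0).
  have ye : ip n y = ip n x0 by have := nx0 y ys; lra.
  rewrite !ipDl !ipZl ye lerD2l ler_pM2l //; apply: dx0.
  by apply/supp_face_hullP; split=> [|z /nx0]; rewrite ?ye //; exact: mem_hull.
rewrite [LHS]supp_face_hull (supp_face_hull s n) [RHS]supp_face_hull -filter_predI.
congr hull; apply: eq_in_filter => y ys /=; rewrite -supp_face_hull.
apply/asboolP/andP =>
  [/supp_face_hullP[hy my]|[/asboolP/supp_faceP[Fy my] /asboolP/supp_face_hullP[hy ny]]].
  have ny : ip n y = ip n x0.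
    have := nx0 y ys; rewrite le_eqVlt => /orP[/eqP //|/(he y ys e ee)].
    by have := my x0 x0s; rewrite leNgt => /negP.
  have Fy : supp_face (hull s) n y.
    by apply/supp_face_hullP; split=> // z zs; rewrite ny nx0.
  split; apply/asboolP => //; apply/supp_faceP; split=> // z /dx0 zx.
  have := my x0 x0s; rewrite !ipDl !ipZl ny lerD2l ler_pM2l //.
  exact: le_trans.
apply/supp_face_hullP; split=> // z zs; apply: le_trans (le z zs) _.
rewrite !ipDl !ipZl lerD ?ler_pM2l //; first exact: ny.
by apply: my; case/supp_faceP: Fx0.
Qed.

Lemma mem_orth (u z : 'rV[R]_3) :
  (z \in lker (linfun (mulmxr u^T : 'rV[R]_3 -> 'rV[R]_1))) = (ip u z == 0).
Proof.
rewrite memv_ker lfunE /= ipC /ip; apply/eqP/eqP => [->|h]; first by rewrite mxE.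
by apply/rowP => i; rewrite (ord1 i) h mxE.
Qed.

Definition direction A (U : {vspace 'rV[R]_3}) :=
  forall W : {vspace 'rV[R]_3}, (U <= W)%VS <-> (forall x y, A x -> A y -> x - y \in W).

Lemma direction_sub A U x y : direction A U -> A x -> A y -> x - y \in U.
Proof. by move=> dU; have [h _] := dU U; apply: h; exact: subvv. Qed.

Lemma directionS A B U V : direction A U -> direction B V -> A `<=` B -> (U <= V)%VS.
Proof.
move=> dU dV AB; have [_ h] := dU V; apply: h => x y /AB Bx /AB By.
exact: direction_sub dV Bx By.
Qed.

Lemma direction_unique A U V : direction A U -> direction A V -> U = V.
Proof.
by move=> dU dV; apply/eqP; rewrite eqEsubv; apply/andP; split; apply: (@directionS A A).
Qed.

(** The orthogonal complement of u is a subspace containing all differences of points of A, hence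
    contains the direction space. *)
Lemma direction_orth A U u : direction A U ->
  (forall x y, A x -> A y -> ip u x = ip u y) -> forall z, z \in U -> ip u z = 0.
Proof.
move=> dU h z zU; apply/eqP; rewrite -mem_orth; apply: subvP zU.
have [_ k] := dU (lker (linfun (mulmxr u^T : 'rV[R]_3 -> 'rV[R]_1))).
by apply: k => x y Ax Ay; rewrite mem_orth ipBr (h x y) // subrr.
Qed.

Lemma direction_hull s : hull s !=set0 -> exists U, direction (hull s) U.
Proof.
move=> /hull_nonempty; case: s => // x0 s _; set s' := x0 :: s.
exists <<[seq x - x0 | x <- s']>>%VS => W; split=> [UW|h].
  have hW x : hull s' x -> x - x0 \in W.
    apply: (@conv_hull_min _ [set x | x - x0 \in W]) => [y z t /= yW zW _|y ys] /=.
      rewrite (_ : _ - x0 = t *: (y - x0) + (1 - t) *: (z - x0)).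
        by rewrite memvD // memvZ.
      rewrite !scalerBr addrACA -opprD -scalerDl (addrC t) subrK scale1r //.
    by apply: subvP UW _ _; apply: memv_span; apply/mapP; exists y.
  move=> x y /hW xW /hW yW; rewrite (_ : x - y = (x - x0) - (y - x0)).
    by rewrite memvB.
  by rewrite opprB addrA subrK.
apply/span_subvP => _ /mapP[x xs ->]; apply: h; apply: mem_hull => //.
exact: mem_head.
Qed.

(** Coordinates turn the sphere of a direction space into one in row vectors of length [\dim U], to
    which [sphere_euler] applies. *)
Lemma vspace_coordinates (U : {vspace 'rV[R]_3}) :
  exists B : 'M[R]_(\dim U, 3),
    [/\ forall c : 'rV_(\dim U), c *m B \in U,
        forall z, z \in U -> exists c : 'rV_(\dim U), z = c *m B
      & forall c : 'rV_(\dim U), c *m B = 0 -> c = 0].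
Proof.
exists (\matrix_i (vbasis U)`_i).
have E (c : 'rV_(\dim U)) : c *m (\matrix_i (vbasis U)`_i) = \sum_i c 0 i *: (vbasis U)`_i.
  by rewrite mulmx_sum_row; apply: eq_bigr => i _; rewrite rowK.
split=> [c|z zU|c].
- rewrite E; apply: memv_suml => i _; apply/memvZ/vbasis_mem/mem_nth.
  by rewrite size_tuple.
- exists (\row_i coord (vbasis U) i z); rewrite E {1}(coord_vbasis zU).
  by apply: eq_bigr => i _; rewrite mxE.
- rewrite E => c0; apply/rowP => i; rewrite mxE.
  by have /freeP/(_ (fun i => c 0 i) c0 i) := basis_free (vbasisP U).
Qed.

Lemma ip_mulmxl k (B : 'M[R]_(k, 3)) (c : 'rV[R]_k) (z : 'rV[R]_3) :
  ip (c *m B) z = ip (z *m B^T) c.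
Proof.
rewrite ipC /ip trmx_mul; congr (_ 0 0); by rewrite mulmxA.
Qed.

(** Injectivity of B makes its Gram matrix invertible, which solves the normal equations. *)
Lemma orthogonal_projection k (B : 'M[R]_(k, 3)) (u : 'rV[R]_3) :
  (forall c : 'rV_k, c *m B = 0 -> c = 0) ->
  exists c : 'rV_k, forall e : 'rV_k, ip (c *m B) (e *m B) = ip u (e *m B).
Proof.
move=> injB; have unit : B *m B^T \in unitmx.
  rewrite -row_free_unit -kermx_eq0; apply/eqP/row_matrixP => i.
  rewrite row0; apply: injB; apply/eqP; rewrite -ip_eq0; apply/eqP.
  rewrite /ip trmx_mul mulmxA -(mulmxA _ B) -row_mul mulmx_ker row0 mul0mx mxE //.
exists (u *m B^T *m invmx (B *m B^T)) => e.
by rewrite /ip trmx_mul !mulmxA -(mulmxA _ B) mulmxKV.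
Qed.

End Hulls.

(** * Dual cones *)

Section DualCone.
Variables (R : realType) (n : nat).
Implicit Types A : set 'rV[R]_n.

Definition dual_cone A : set 'rV[R]_n := [set c | forall z, A z -> 0 <= ip z c].

Lemma closed_dual_cone A : closed (dual_cone A).
Proof.
have -> : dual_cone A = \bigcap_(z in A) [set c | 0 <= ip z c] by [].
by apply: closed_bigI => z _; exact: closed_ip_ge.
Qed.

Lemma cvx_dual_cone A : cvx (dual_cone A).
Proof. by move=> x y t hx hy t01 z Az; apply: cvx_ip_ge (t01); [exact: hx|exact: hy]. Qed.

Lemma dual_coneZ A u (t : R) : dual_cone A u -> 0 <= t -> dual_cone A (t *: u).
Proof. by move=> hu t0 z Az; rewrite ipZr mulr_ge0 // hu. Qed.

End DualCone.

(** * Dimension of a face and the finite set of faces *)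

Section Faces.
Variable R : realType.
Implicit Types (A G H : set 'rV[R]_3) (s : seq 'rV[R]_3) (u v : 'rV[R]_3).

(** [has_dim] as a function; the default 0 is reached only by sets without a dimension, such as the
    empty set. *)
Definition fdim A : nat := xget 0%N [set d | has_dim A d].

Lemma has_dimP A d : has_dim A d <-> A !=set0 /\ exists2 U, direction A U & \dim U = d.
Proof.
by split=> -[A0]; [case=> U [? ?]|case=> U ? ?]; split=> //; exists U.
Qed.

Lemma fdim_eq A d : has_dim A d -> fdim A = d.
Proof.
move=> hd; rewrite /fdim; case: xgetP => [e _ /= he|/(_ d)] //.
have /has_dimP[_ [U dU <-]] := hd; have /has_dimP[_ [V dV <-]] := he.
by rewrite (direction_unique dU dV).
Qed.

(** Nonzero directions give the same faces as unit ones and spare a normalisation after each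
    tilt. *)
Definition faces A := [set H | exists2 u, u != 0 & H = supp_face A u].

Lemma supp_faceZ A u (t : R) : 0 < t -> supp_face A (t *: u) = supp_face A u.
Proof.
by move=> t0; apply/seteqP; split=> x /supp_faceP[Ax mx]; apply/supp_faceP;
  split=> // y Ay; have := mx y Ay; rewrite !ipZl ler_pM2l.
Qed.

Lemma sphereP u : sphere u <-> ip u u = 1. Proof. by []. Qed.

Lemma normalize_sphere u : u != 0 -> exists2 t : R, 0 < t & sphere (t *: u).
Proof.
move=> u0; have p : 0 < ip u u by rewrite lt_neqAle eq_sym ip_eq0 u0 ip_ge0.
exists (Num.sqrt (ip u u))^-1; first by rewrite invr_gt0 sqrtr_gt0.
apply/sphereP; rewrite ipZl ipZr mulrA -invfM -expr2 sqr_sqrtr ?ltW //.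
by rewrite mulVf // gt_eqF.
Qed.

Lemma sphere_neq0 u : sphere u -> u != 0.
Proof. exact: ip_eq1_neq0. Qed.

Lemma faceP A d H : face A d H <-> faces A H /\ has_dim H d.
Proof.
split=> [[[u su ->] hd]|[[u u0 ->] hd]]; split=> //.
  by exists u => //; exact: sphere_neq0.
by have [t t0 st] := normalize_sphere u0; exists (t *: u); rewrite ?supp_faceZ.
Qed.

(** By [supp_face_hull] every face is the hull of a sublist of the generators, and a list has
    finitely many masks. *)
Lemma finite_faces s : finite_set (faces (hull s)).
Proof.
apply: (@sub_finite_set _ _
    [set` map (fun m : (size s).-tuple bool => hull (mask m s)) (enum {: (size s).-tuple bool})]).
  move=> _ [u _ ->] /=; rewrite supp_face_hull filter_mask.
  apply/mapP; exists (map_tuple (fun x => `[< supp_face (hull s) u x >]) (in_tuple s)).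
    by rewrite mem_enum.
  by [].
by apply/finite_seqP; eexists.
Qed.

Lemma mem_faces s H : H \in fset_set (faces (hull s)) <-> faces (hull s) H.
Proof. by rewrite in_fset_set ?inE //; exact: finite_faces. Qed.

End Faces.

(** * Faces of a full-dimensional polytope and their Euler relation *)

Section Polytope.
Variables (R : realType) (s : seq 'rV[R]_3).
Hypothesis full : has_dim (hull s) 3.
Implicit Types (G H : set 'rV[R]_3) (u v : 'rV[R]_3).
Local Notation P := (hull s).
Local Notation F := (supp_face P).
Local Notation FF := (fset_set (faces P)).

Lemma P_nonempty : P !=set0. Proof. by case: full. Qed.

Lemma supp_face_direction u : exists2 U, direction (F u) U & \dim U = fdim (F u).
Proof.
have Fn : F u !=set0 by have [x _ ?] := supp_face_nonempty u P_nonempty; exists x.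
have [U dU] : exists U, direction (F u) U.
  by rewrite supp_face_hull; apply: direction_hull; rewrite -supp_face_hull.
exists U => //; apply/esym/fdim_eq/has_dimP; split=> //; by exists U.
Qed.

Lemma supp_face_has_dim u : has_dim (F u) (fdim (F u)).
Proof.
have [U dU e] := supp_face_direction u; apply/has_dimP; split; last by exists U.
by have [x _ ?] := supp_face_nonempty u P_nonempty; exists x.
Qed.

Lemma const_on_P u : (forall x y, P x -> P y -> ip u x = ip u y) -> u = 0.
Proof.
move=> h; have /has_dimP[_ [U dU dim3]] := full.
have Uf : U = fullv by apply/eqP; rewrite eqEdim subvf /= dimvf dim3.
apply/eqP; rewrite -ip_eq0; apply/eqP; apply: (direction_orth dU h).
by rewrite Uf memvf.
Qed.

Lemma const_on_seq u c : (forall x, x \in s -> ip u x = c) -> u = 0.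
Proof.
move=> h; apply: const_on_P => x y /(conv_hull_ip_eq h) -> /(conv_hull_ip_eq h) ->.
by [].
Qed.

Lemma supp_face_proper u : u != 0 -> ~ (P `<=` F u).
Proof.
move=> /eqP u0 PF; apply: u0; apply: const_on_P => x y Px Py.
have /supp_faceP[_ mx] := PF x Px; have /supp_faceP[_ my] := PF y Py.
by apply/eqP; rewrite eq_le mx ?my.
Qed.

Lemma supp_face_full : F 0 = P. Proof. exact: supp_face0. Qed.

Lemma subface_dim G u v : G = F v -> F u `<=` G -> (fdim (F u) <= fdim G)%N.
Proof.
move=> -> uG; have [U dU <-] := supp_face_direction u.
have [V dV <-] := supp_face_direction v; apply: dimvS.
exact: directionS dU dV uG.
Qed.

Lemma const_on_subface u v : F u `<=` F v ->
  (forall x y, F v x -> F v y -> ip u x = ip u y) -> F v `<=` F u.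
Proof.
move=> uv c x Fx; have [y _ Fy] := supp_face_nonempty u P_nonempty.
have /supp_faceP[_ my] := Fy; apply/supp_faceP; split; first by case: Fx.
by move=> z /my; rewrite (c x y) //; exact: uv.
Qed.

(** Equal dimensions force equal direction spaces, so u, constant on the smaller face, is constant
    on the larger one too. *)
Lemma subface_eq u v : F u `<=` F v -> fdim (F u) = fdim (F v) -> F u = F v.
Proof.
move=> uv duv; apply/seteqP; split=> //; apply: const_on_subface => // x y Fx Fy.
have [U dU eU] := supp_face_direction u; have [V dV eV] := supp_face_direction v.
have UV : U = V by apply/eqP; rewrite eqEdim (directionS dU dV uv) eU eV duv /=.
apply/eqP; rewrite -subr_eq0 -ipBr; apply/eqP; apply: (direction_orth dU); last first.
  by rewrite UV; exact: direction_sub dV Fx Fy.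
move=> a b /supp_faceP[Pa ma] /supp_faceP[Pb mb].
by apply/eqP; rewrite eq_le ma ?mb.
Qed.

Lemma proper_subface_dim u v : F u `<` F v -> (fdim (F u) < fdim (F v))%N.
Proof.
move=> [uv nvu]; rewrite ltn_neqAle (subface_dim (erefl _) uv) andbT.
by apply/eqP => /(subface_eq uv) e; apply: nvu; rewrite e.
Qed.

Lemma fdim_full : fdim P = 3%N. Proof. exact: fdim_eq. Qed.

Lemma fdim_le2 u : u != 0 -> (fdim (F u) <= 2)%N.
Proof.
move=> u0; rewrite -ltnS -fdim_full -{2}supp_face_full; apply: proper_subface_dim.
by rewrite supp_face_full; split=> [x []//|]; exact: supp_face_proper.
Qed.

Definition fsign G : int := (-1) ^+ fdim G.

(* Valid for u = 0 too, where F u = P. The sphere is that of the direction space of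
   F u; by tilting, the faces of F u maximising a direction of that space form
   a face of P of smaller dimension. *)
Lemma face_count u :
  \sum_(H <- FF | `[< H `<` F u >]) fsign H = 1 - (-1) ^+ fdim (F u).
Proof.
have [k] := ubnP (fdim (F u)); elim: k u => // k IH n; rewrite ltnS => nk.
have [U dU eU] := supp_face_direction n.
have [B [BU UB injB]] := vspace_coordinates U.
have /choice[p hp] : forall H, exists p, H !=set0 -> H p.
  by move=> H; have [[q Hq]|?] := pselect (H !=set0); [exists q | exists 0].
(* The normal cone of H relative to [F n], in coordinates c on the direction space. *)
pose C H := dual_cone [set z | exists x y, [/\ H x, F n y & z = (x - y) *m B^T]].
have CP H c : C H c <-> forall x y, H x -> F n y -> ip (c *m B) y <= ip (c *m B) x.
  split=> [h x y Hx Fy|h _ [x [y [Hx Fy ->]]]].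
    by rewrite -subr_ge0 -ipBr ip_mulmxl; apply: h; exists x, y.
  by rewrite -ip_mulmxl ipBr subr_ge0 h.
pose r := [seq H <- FF | `[< H `<=` F n >]].
have rP H : H \in r -> exists2 u, u != 0 & H = F u /\ F u `<=` F n.
  by rewrite mem_filter => /andP[/asboolP Hn /mem_faces[u u0 e]]; exists u; rewrite -?e.
have Cn H c : H \in r -> C H c <-> H `<=` supp_face (F n) (c *m B).
  move=> /rP[u _ [e uF]]; rewrite CP; split=> [h x Hx|h x y /h/supp_faceP[_]]; last exact.
  by apply/supp_faceP; split=> [|y]; [apply: uF; rewrite -e | exact: h].
(* The form for H sums p H - y over the generators y of [F n]: on [C H] every term is nonnegative,
   and all vanish only if c is constant on [F n], that is for c = 0. *)
have := @sphere_euler R (\dim U) _ r fsign C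
  (fun H => \sum_(y <- s | `[< F n y >]) (p H - y) *m B^T)
  (fun H => @closed_dual_cone _ _ _) (fun H => @cvx_dual_cone _ _ _)
  (fun H => @dual_coneZ _ _ _) _ _.
move=> E; rewrite -eU -[RHS]E {E}.
- rewrite /r big_filter_cond; rewrite [LHS]big_seq_cond [RHS]big_seq_cond.
  apply: eq_bigl => H; case: (boolP (H \in _)) => //= /mem_faces[u u0 eH].
  have [Hn|Hn] := pselect (H `<=` F n); last first.
    rewrite [X in X && _](_ : _ = false) /=; last exact/asboolP.
    by apply/asboolP => -[].
  rewrite [X in X && _](_ : _ = true) /=; last exact/asboolP.
  have Hr : H \in r.
    by rewrite mem_filter; apply/andP; split; [exact/asboolP|apply/mem_faces; exists u].
  apply/asbool_equiv_eq; split=> [[_ nH]|[c c0]].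
    (* The witness is the projection to U of a normal u of H; if it were 0, u would be constant on
       [F n] and H would be all of it. *)
    have [c hc] := orthogonal_projection u injB; exists c; last first.
      apply/(Cn _ _ Hr) => x Hx; apply/supp_faceP; split=> [|y Fy]; first exact: Hn.
      have xyU : x - y \in U by apply: direction_sub dU _ Fy; exact: Hn.
      have [e xe] := UB _ xyU.
      rewrite -subr_ge0 -ipBr xe hc -xe ipBr subr_ge0.
      by move: Hx; rewrite eH => /supp_faceP[_]; apply; case: Fy.
    apply/eqP => c0; apply: nH; rewrite eH in Hn *; apply: const_on_subface => // x y Fx Fy.
    have [e xe] := UB _ (direction_sub dU Fx Fy).
    by apply/eqP; rewrite -subr_eq0 -ipBr xe -hc -xe c0 mul0mx ip0l.
  move=> /(Cn _ _ Hr) Hc; split=> // nH; move/eqP: c0; apply; apply: injB.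
  apply/eqP; rewrite -ip_eq0; apply/eqP; apply: (direction_orth dU) (BU c).
  move=> x y /nH/Hc/supp_faceP[Fx mx] /nH/Hc/supp_faceP[Fy my].
  by apply/eqP; rewrite eq_le mx ?my.
- move=> H c Hr /(Cn _ _ Hr) Hc c0; have [u u0 [eH uF]] := rP H Hr.
  have Hp : H (p H).
    by apply: hp; rewrite eH; have [x _ ?] := supp_face_nonempty u P_nonempty; exists x.
  have /supp_faceP[Fp mp] := Hc _ Hp.
  have E : ip (\sum_(y <- s | `[< F n y >]) (p H - y) *m B^T) c =
      \sum_(y <- s | `[< F n y >]) (ip (c *m B) (p H) - ip (c *m B) y).
    rewrite -[in LHS]big_filter ip_suml big_filter.
    by apply: eq_bigr => y _; rewrite -ip_mulmxl ipBr.
  have ge0 y : `[< F n y >] -> 0 <= ip (c *m B) (p H) - ip (c *m B) y.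
    by move=> /asboolP Fy; rewrite subr_ge0 mp.
  rewrite E lt_neqAle sumr_ge0 // andbT eq_sym; apply: contra c0 => S0.
  move: S0; rewrite psumr_eq0 // => /allP S0.
  apply/eqP/injB/eqP; rewrite -ip_eq0; apply/eqP; apply: (direction_orth dU) (BU c).
  suff h x : F n x -> ip (c *m B) x = ip (c *m B) (p H) by move=> x y /h-> /h->.
  rewrite supp_face_hull; apply: conv_hull_ip_eq => y /=.
  rewrite mem_filter => /andP[Fy ys]; have := S0 y ys; rewrite Fy subr_eq0.
  by move=> /eqP.
- move=> c c0; have [e e0 tilt] := supp_face_tilt n (c *m B) P_nonempty.
  have ncn : ~ (F n `<=` F (n + e *: (c *m B))).
    rewrite tilt => h; move/eqP: c0; apply; apply: injB.
    apply/eqP; rewrite -ip_eq0; apply/eqP; apply: (direction_orth dU) (BU c).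
    move=> x y /h/supp_faceP[Fx mx] /h/supp_faceP[Fy my].
    by apply/eqP; rewrite eq_le mx ?my.
  set v := n + e *: (c *m B) in tilt ncn *.
  have vn : F v `<=` F n by rewrite tilt => x [].
  have v0 : v != 0.
    by apply/eqP => v0; apply: ncn; rewrite v0 supp_face_full => x [].
  have vr : F v \in r.
    by rewrite mem_filter; apply/andP; split; [exact/asboolP|apply/mem_faces; exists v].
  have ur : uniq r by rewrite filter_uniq // fset_uniq.
  (* The faces on which c is maximal are the subfaces of [F v]: [F v] itself contributes (-1)^dim,
     its proper subfaces 1 - (-1)^dim by induction. *)
  rewrite big_mkcond (bigD1_seq (F v)) //= ifT; last first.
    by apply/asboolP; apply/(Cn _ _ vr); rewrite tilt.
  rewrite -big_mkcondr /= /r big_filter_cond.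
  have : (fdim (F v) < k)%N by apply: leq_trans nk; apply: proper_subface_dim; split.
  move=> /IH; rewrite /fsign => Ev; rewrite -[RHS](subrK ((-1) ^+ fdim (F v))) addrC -Ev.
  congr (_ + _); rewrite [LHS]big_seq_cond [RHS]big_seq_cond.
  apply: eq_bigl => H; case: (boolP (H \in _)) => //= HFF.
  apply/andP/asboolP => [[/asboolP Hn /andP[Hv /asboolP HC]]|[Hv nH]].
    have Hr : H \in r by rewrite mem_filter HFF andbT; apply/asboolP.
    have HvS : H `<=` F v by rewrite tilt; apply/(Cn _ _ Hr).
    by split=> // vH; move/eqP: Hv; apply; apply/seteqP.
  have Hn : H `<=` F n by apply: subset_trans Hv vn.
  have Hr : H \in r by rewrite mem_filter HFF andbT; apply/asboolP.
  split; first exact/asboolP.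
  apply/andP; split; last by apply/asboolP; apply/(Cn _ _ Hr); rewrite -tilt.
  by apply/eqP => e'; apply: nH; rewrite e'.
Qed.

End Polytope.

(** * Normals to subspaces of three-space *)

Section Orthogonality.
Variable R : realType.
Implicit Types (U : {vspace 'rV[R]_3}) (u v g z : 'rV[R]_3).

(** The part of v orthogonal to u is also orthogonal to U. Were it nonzero, it would span the whole
    space together with U, and u, orthogonal to both, would vanish. *)
Lemma orth_unique U u v : (2 <= \dim U)%N -> u != 0 ->
  (forall z, z \in U -> ip u z = 0) -> (forall z, z \in U -> ip v z = 0) ->
  exists t : R, v = t *: u.
Proof.
move=> dU u0 uU vU; have uu0 : ip u u != 0 by rewrite ip_eq0.
exists (ip v u / ip u u); apply/eqP; rewrite -subr_eq0; apply/eqP.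
set v' := v - _ *: u.
have v'u : ip u v' = 0 by rewrite ipBr ipZr divfK // ipC subrr.
have v'U z : z \in U -> ip v' z = 0.
  by move=> zU; rewrite /v' ipBl ipZl (uU z zU) (vU z zU) mulr0 subrr.
apply/eqP; apply: contra_neqT u0 => v'0.
have UV : (U <= U + <[v']>)%VS by exact: addvSl.
have full : (U + <[v']>)%VS = fullv.
  apply/eqP; rewrite eqEdim subvf dimvf /= -[leqLHS]/3%N.
  have : (2 <= \dim (U + <[v']>))%N by apply: leq_trans dU (dimvS UV).
  rewrite leq_eqVlt => /orP[/eqP e2|//].
  have /eqP EU : U == (U + <[v']>)%VS by rewrite eqEdim UV -e2.
  have v'in : v' \in U by rewrite EU (subvP (addvSr U _)) // memv_line.
  by move: v'0; rewrite -ip_eq0 v'U // eqxx.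
apply/eqP; rewrite -ip_eq0; apply/eqP.
have /memv_addP[z zU [_ /vlineP[k ->] e]] : u \in (U + <[v']>)%VS by rewrite full memvf.
by rewrite {2}e ipDr ipZr (uU z zU) v'u mulr0 addr0.
Qed.

(** A vector outside U minus its orthogonal projection to U. *)
Lemma orth_exists U : (\dim U <= 2)%N ->
  exists2 g, g != 0 & forall z, z \in U -> ip g z = 0.
Proof.
move=> dU; have [B [BU UB injB]] := vspace_coordinates U.
have [z zU] : exists z, z \notin U.
  apply: contrapT => h; have : (fullv <= U)%VS.
    by apply/subvP => z _; apply: contrapT => /negP zU; apply: h; exists z.
  by move=> /dimvS; rewrite dimvf /= -[X in (X <= _)%N]/3%N leqNgt ltnS dU.
have [c hc] := orthogonal_projection z injB.
exists (z - c *m B) => [|y /UB[e ->]]; last by rewrite ipBl hc subrr.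
by rewrite subr_eq0; apply: contra zU => /eqP ->.
Qed.

End Orthogonality.

(** * Opposite faces *)

Section Facets.
Variables (R : realType) (s : seq 'rV[R]_3).
Hypothesis full : has_dim (hull s) 3.
Implicit Types (G H : set 'rV[R]_3) (u v : 'rV[R]_3).
Local Notation P := (hull s).
Local Notation F := (supp_face P).
Local Notation FF := (fset_set (faces P)).

Lemma mem_FF u : u != 0 -> F u \in FF.
Proof. by move=> u0; apply/mem_faces; exists u. Qed.

(** Adding the face itself cancels the power of -1 in [face_count]. This is the pointwise identity
    that [opp_count] integrates. *)
Lemma face_count_closed u : u != 0 -> \sum_(H <- FF | `[< H `<=` F u >]) fsign H = 1.
Proof.
move=> u0; rewrite big_mkcond (bigD1_seq (F u)) ?mem_FF ?fset_uniq //=.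
rewrite ifT; last exact/asboolP.
rewrite -big_mkcondr /= -[RHS](subrK (fsign (F u))) -(face_count full) addrC.
congr (_ + _); apply: eq_bigl => H; apply/andP/asboolP => [[/eqP Hn /asboolP Hu]|[Hu nH]].
  by split=> // uH; apply: Hn; apply/seteqP.
by split; [apply/eqP => e; apply: nH; rewrite e|exact/asboolP].
Qed.

(** Antipodality lifted to faces: it agrees with that of points on singletons, and with that of
    midpoints on edges. *)
Definition opp_touch G H := `[< exists u, [/\ u != 0, G `<=` F u & H `<=` F (- u)] >].

Lemma opp_touchC G H : opp_touch G H = opp_touch H G.
Proof.
by apply/asbool_equiv_eq; split=> -[u [u0 Gu Hu]]; exists (- u);
  rewrite opprK oppr_eq0.
Qed.

(** No term is negative, and all vanish only if u is constant on P. The form cuts a base out of the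
    normal cone of any face through x. *)
Lemma center_gt0 x u : u != 0 -> F u x -> 0 < ip (\sum_(y <- s) (x - y)) u.
Proof.
move=> u0 /supp_faceP[Px mx]; rewrite ip_suml.
have ge0 y : y \in s -> 0 <= ip (x - y) u.
  by move=> /mem_hull/mx; rewrite ipBl subr_ge0 !(ipC u).
rewrite lt_neqAle big_seq sumr_ge0 // andbT eq_sym; apply: contra u0.
rewrite psumr_eq0 // => /allP S0; apply/eqP; apply: (const_on_seq full (c := ip u x)).
move=> y ys; have := S0 y ys; rewrite ys ipBl subr_eq0 !(ipC u) => /eqP.
by move=> ->.
Qed.

(** Normal cones are dual cones, hence closed, convex and stable under scaling. *)
Lemma subset_supp_face G u : (exists v, G = F v) ->
  G `<=` F u <-> dual_cone [set z | exists x y, [/\ G x, P y & z = x - y]] u.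
Proof.
move=> [v Gv]; split=> [h _ [x [y [Gx Py ->]]]|h x Gx].
  have /supp_faceP[_ mx] := h x Gx.
  by rewrite ipBl subr_ge0 !(ipC _ u) mx.
apply/supp_faceP; split=> [|y Py]; first by move: Gx; rewrite Gv => -[].
by rewrite -subr_ge0 -ipBr ipC; apply: h; exists x, y.
Qed.

(** [euler_one] on the base [K0] of the normal cone of G, with the reflected normal cones [K H]; on
    [K0] the value 1 is [face_count_closed] at -u. *)
Lemma opp_count G : faces P G -> \sum_(H <- FF | opp_touch G H) fsign H = 1.
Proof.
move=> [n n0 Gn]; have [x _ Fx] := supp_face_nonempty n (P_nonempty full).
pose N H := dual_cone [set z | exists x y, [/\ H x, P y & z = x - y]].
have NP H u : H \in FF -> H `<=` F u <-> N H u.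
  by move=> /mem_faces[v _ ?]; apply: subset_supp_face; exists v.
pose w := \sum_(y <- s) (x - y).
pose K0 := N G `&` [set u | ip w u = 1].
pose K H := dual_cone [set z | exists x y, [/\ H x, P y & z = - (x - y)]].
have KP H u : H \in FF -> H `<=` F (- u) <-> K H u.
  move=> HFF; rewrite NP //; split=> h.
    move=> _ [a [b [Ha Pb ->]]]; rewrite ipNl -ipNr; apply: h; by exists a, b.
  move=> _ [a [b [Ha Pb ->]]]; rewrite ipNr -ipNl; apply: h; by exists a, b.
have Gx : G x by rewrite Gn.
have GFF : G \in FF by rewrite Gn mem_FF.
have wpos u : u != 0 -> N G u -> 0 < ip w u.
  by move=> u0 /(NP _ _ GFF) Gu; apply: center_gt0 => //; exact: Gu.
rewrite -[RHS](@euler_one R 3 _ FF (@fsign R) K K0) //.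
- rewrite big_seq_cond [RHS]big_seq_cond; apply: eq_bigl => H.
  case: (boolP (H \in FF)) => HFF; rewrite ?HFF ?(negbTE HFF) //=; apply/asbool_equiv_eq.
  split=> [[u [u0 Gu Hu]]|[u [Ku [NGu wu]]]]; last first.
    exists u; split; [exact: ip_eq1_neq0 wu|exact/NP|exact/KP].
  have p : 0 < ip w u by apply: wpos => //; apply/NP.
  have p' : 0 < (ip w u)^-1 by rewrite invr_gt0.
  exists ((ip w u)^-1 *: u); split; first by apply: dual_coneZ (ltW p'); apply/KP.
  split; first by apply: dual_coneZ (ltW p'); apply/NP.
  by rewrite /= ipZr mulVf // gt_eqF.
- by move=> H; exact: closed_dual_cone.
- by move=> H; exact: cvx_dual_cone.
- by apply: closedI; [exact: closed_dual_cone|exact: closed_ip_eq].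
- by apply: cvxI; [exact: cvx_dual_cone|exact: cvx_ip_eq].
- have p : 0 < ip w n by apply: wpos => //; apply/(NP _ _ GFF); rewrite Gn.
  exists ((ip w n)^-1 *: n); split.
    by apply: dual_coneZ; [apply/(NP _ _ GFF); rewrite Gn|rewrite invr_ge0 ltW].
  by rewrite /= ipZr mulVf // gt_eqF.
- move=> u [_ wu]; have u0 := ip_eq1_neq0 wu.
  rewrite -[RHS](@face_count_closed (- u)) ?oppr_eq0 //.
  rewrite big_seq_cond [RHS]big_seq_cond; apply: eq_bigl => H.
  case: (boolP (H \in FF)) => HFF; rewrite ?HFF ?(negbTE HFF) //=; apply/asbool_equiv_eq.
  by rewrite KP.
Qed.

Lemma supp_face_orth u v U : direction (F u) U -> F u `<=` F v ->
  forall z, z \in U -> ip v z = 0.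
Proof.
move=> dU uv; apply: (direction_orth dU) => x y /uv/supp_faceP[Px mx] /uv/supp_faceP[Py my].
by apply/eqP; rewrite eq_le mx ?my.
Qed.

(** Both directions are orthogonal to a plane, hence proportional; a negative factor would make all
    of P maximal for u. *)
Lemma facet_normal u v : fdim (F u) = 2%N -> u != 0 -> v != 0 -> F u `<=` F v ->
  exists2 t : R, 0 < t & v = t *: u.
Proof.
move=> d2 u0 v0 uv; have [U dU eU] := supp_face_direction full u.
have [|t vt] := orth_unique _ u0 (supp_face_orth dU (@subset_refl _ _)) (supp_face_orth dU uv).
  by rewrite eU d2.
exists t => //; rewrite ltNge; apply/negP => t0.
apply: (supp_face_proper full u0) => y Py.
have [x _ Fx] := supp_face_nonempty u (P_nonempty full).
have /supp_faceP[Px mx] := Fx; have /uv/supp_faceP[_ mv] := Fx.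
have tn : t < 0 by rewrite lt_neqAle t0 andbT; apply: contra v0 => /eqP t1; rewrite vt t1 scale0r.
have := mv y Py; rewrite vt !ipZl ler_nM2l // => xy.
by apply/supp_faceP; split=> // z /mx zx; apply: le_trans zx xy.
Qed.

Lemma opp_touch_facet G u : u != 0 -> fdim (F u) = 2%N ->
  opp_touch G (F u) = `[< G `<=` F (- u) >].
Proof.
move=> u0 d2; apply/asbool_equiv_eq; split=> [[v [v0 Gv]]|Gu]; last first.
  by exists (- u); rewrite oppr_eq0 opprK; split.
move=> /(facet_normal d2 u0)[|t t0 vt]; first by rewrite oppr_eq0.
by rewrite -(supp_faceZ _ _ t0) scalerN -vt opprK.
Qed.

End Facets.

(** * The two facets through an edge, and edges as segments *)

Section EdgeFacets.
Variables (R : realType) (s : seq 'rV[R]_3).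
Hypothesis full : has_dim (hull s) 3.
Implicit Types (G H : set 'rV[R]_3) (u v g : 'rV[R]_3).
Local Notation P := (hull s).
Local Notation F := (supp_face P).
Local Notation FF := (fset_set (faces P)).

Section Pencil.
Variables (n x0 : 'rV[R]_3) (U : {vspace 'rV[R]_3}).
Hypotheses (n0 : n != 0) (Fx0 : F n x0) (dU : direction (F n) U) (dim1 : \dim U = 1%N).
Let w := \sum_(y <- s) (x0 - y).

Lemma pencil_orth u : (forall z, z \in U -> ip u z = 0) -> forall x, F n x -> ip u x = ip u x0.
Proof.
move=> uU x Fx; apply/eqP; rewrite -subr_eq0 -ipBr uU //.
exact: direction_sub dU Fx Fx0.
Qed.

Lemma pencil_subface u : (forall z, z \in U -> ip u z = 0) ->
  F n `<=` F u <-> forall y, y \in s -> 0 <= ip u (x0 - y).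
Proof.
move=> uU; split=> [h y ys|h x Fx].
  have /h/supp_faceP[_ mx] := Fx0.
  by rewrite ipBr subr_ge0 mx //; exact: mem_hull.
apply/supp_face_hullP; split=> [|y ys]; first by case: Fx.
by rewrite (pencil_orth uU Fx) -subr_ge0 -ipBr h.
Qed.

(* The pencil n + t g leaves the normal cone of the edge at the smallest ratio
   between the slacks of n and the slopes of g. *)
Lemma pencil_facet g : g != 0 -> (forall z, z \in U -> ip g z = 0) -> ip w g = 0 ->
  exists2 t : R, 0 < t & [/\ F n `<=` F (n + t *: g), fdim (F (n + t *: g)) = 2%N &
    forall t', 0 <= t' -> F n `<=` F (n + t' *: g) ->
      fdim (F (n + t' *: g)) = 2%N -> t' = t].
Proof.
move=> g0 gU wg.
have nU := supp_face_orth dU (@subset_refl _ _).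
have tU t z : z \in U -> ip (n + t *: g) z = 0.
  by move=> zU; rewrite ipDl ipZl nU // gU // mulr0 addr0.
have age y : y \in s -> 0 <= ip n (x0 - y).
  by move: y; apply/(pencil_subface nU).
have agt y : y \in s -> ~ F n y -> 0 < ip n (x0 - y).
  move=> ys nFy; rewrite lt_neqAle age // andbT; apply/eqP => e; apply: nFy.
  apply/supp_face_hullP; split=> [|z zs]; first exact: mem_hull.
  by have := age z zs; move: e; rewrite !ipBr; lra.
have bF y : F n y -> ip g (x0 - y) = 0.
  by move=> Fy; rewrite ipBr (pencil_orth gU Fy) subrr.
(* The slopes add up to 0 since w is orthogonal to g; if none were negative, all would vanish and g
   would be constant on P. *)
have [y0 y0s y0b] : exists2 y, y \in s & ip g (x0 - y) < 0.
  apply: contrapT => h; have b0 y : y \in s -> 0 <= ip g (x0 - y).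
    by move=> ys; rewrite leNgt; apply/negP => b; apply: h; exists y.
  have S0 : \sum_(y <- s) ip g (x0 - y) = 0.
    by rewrite -[RHS]wg ip_suml; apply: eq_bigr => y _; rewrite ipC.
  move/eqP: g0; apply; apply: (const_on_seq full (c := ip g x0)) => y ys.
  move/eqP: S0; rewrite big_seq psumr_eq0 // => /allP/(_ y ys).
  by rewrite ys ipBr subr_eq0 => /eqP.
pose s' := [seq y <- s | ip g (x0 - y) < 0].
have [|y1 y1s' my1] := @seq_max R _ (fun y => ip n (x0 - y) / ip g (x0 - y)) s'.
  by apply/eqP => s'0; have : y0 \in s' by [rewrite mem_filter y0b]; rewrite s'0.
move: (y1s'); rewrite mem_filter => /andP[b1 y1s].
(* The slopes are negative, so the largest quotient yields the least ratio of slack to absolute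
   slope. *)
set t := - (ip n (x0 - y1) / ip g (x0 - y1)).
have nFy1 : ~ F n y1 by move=> /bF b1'; move: b1; rewrite b1' ltxx.
have a1 := agt y1 y1s nFy1.
have t0 : 0 < t by rewrite /t -mulrN -invrN divr_gt0 // oppr_gt0.
have tb1 : ip n (x0 - y1) = - t * ip g (x0 - y1).
  by rewrite /t opprK divfK // lt_eqF.
have tb y : y \in s -> ip g (x0 - y) < 0 -> - t * ip g (x0 - y) <= ip n (x0 - y).
  move=> ys b; have : y \in s' by rewrite mem_filter b.
  move=> /my1; rewrite -[leRHS]opprK -/t.
  by rewrite ler_ndivrMr.
have Ft : F n `<=` F (n + t *: g).
  apply/pencil_subface; first exact: tU.
  move=> y ys; rewrite ipDl ipZl; have := age y ys.
  have [b|b] := ltrP (ip g (x0 - y)) 0; last by nra.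
  by have := tb y ys b; lra.
have wn : 0 < ip w n by apply: center_gt0.
have u0 t' : n + t' *: g != 0.
  apply/eqP => e; have : ip w (n + t' *: g) = 0 by rewrite e ip0r.
  by rewrite ipDr ipZr wg; lra.
have dF : fdim (F n) = 1%N.
  by rewrite -dim1; have [V dV <-] := supp_face_direction full n; rewrite (direction_unique dU dV).
exists t => //; split=> //.
  apply/eqP; rewrite eqn_leq fdim_le2 //=.
  suff : (fdim (F n) < fdim (F (n + t *: g)))%N by rewrite dF.
  apply: proper_subface_dim => //.
  (* At t the generator [y1], which lies outside [F n], becomes maximal. *)
  split=> // h; apply: nFy1; apply: h; apply/supp_face_hullP; split; first exact: mem_hull.
  move=> y ys; have /(pencil_subface (tU t))/(_ y ys) := Ft.
  have : ip (n + t *: g) (x0 - y1) = 0 by rewrite ipDl ipZl tb1 mulNr addNr.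
  by rewrite !ipBr; lra.
(* Beyond t, [y1] overtakes [x0]; before t, no generator outside [F n] is maximal and the face has
   dimension at most 1. *)
move=> t' t'0 Ft' d2; apply/eqP; rewrite eq_le; apply/andP; split.
  have /(pencil_subface (tU t'))/(_ y1 y1s) := Ft'.
  by rewrite ipDl ipZl tb1; nra.
rewrite leNgt; apply/negP => tt'.
suff : (fdim (F (n + t' *: g)) <= fdim (F n))%N by rewrite d2 dF.
apply: (subface_dim full (erefl (F n))).
rewrite (supp_face_hull s (n + _)); apply: conv_hull_min.
  by apply: cvx_supp_face; exact: cvx_conv_hull.
move=> y /=; rewrite mem_filter => /andP[/asboolP/supp_face_hullP[_ my] ys].
apply: contrapT => /(agt y ys) ay.
have x0s : ip (n + t' *: g) (x0 - y) <= 0.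
  have /Ft'/supp_faceP[hx _] := Fx0.
  rewrite ipBr subr_le0.
  by move: hx; apply: conv_hull_ip_le => z; exact: my.
move: x0s; rewrite ipDl ipZl.
have [b|b] := ltrP (ip g (x0 - y)) 0; last by nra.
by have := tb y ys b; nra.
Qed.

End Pencil.

(** Up to scaling, facet normals at the edge lie on the line n + t g, where g is orthogonal to the
    edge and to w. [pencil_facet] for g and for -g finds exactly one on each side of n. *)
Lemma edge_facets n : n != 0 -> fdim (F n) = 1%N ->
  \sum_(H <- FF | (fdim H == 2%N) && `[< F n `<=` H >]) (1 : int) = 2.
Proof.
move=> n0 dF; have [U dU eU] := supp_face_direction full n.
have dim1 : \dim U = 1%N by rewrite eU.
have [x0 _ Fx0] := supp_face_nonempty n (P_nonempty full).
pose w := \sum_(y <- s) (x0 - y).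
have wn : 0 < ip w n by apply: (center_gt0 full).
pose U2 := (U + <[w]>)%VS.
have nU := supp_face_orth dU (@subset_refl _ _).
have [|g g0 gU2] := @orth_exists R U2.
  apply: leq_trans (dimv_add_leqif _ _) _.
  by rewrite dim1 dim_vline; case: (w != 0).
have gU z : z \in U -> ip g z = 0.
  by move=> zU; apply: gU2; apply: subvP (addvSl _ _) _ zU.
have wg : ip w g = 0.
  by rewrite ipC gU2 // (subvP (addvSr _ _)) // memv_line.
have dU2 : (2 <= \dim U2)%N.
  suff : (\dim U < \dim U2)%N by rewrite dim1.
  rewrite ltnNge; apply/negP => le.
  have /eqP e : U == U2 by rewrite eqEdim addvSl.
  have : w \in U by rewrite e (subvP (addvSr _ _)) // memv_line.
  by move=> /nU; rewrite ipC; lra.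
have [t1 t10 [S1 d1 q1]] := pencil_facet n0 Fx0 dU dim1 g0 gU wg.
have ng0 : - g != 0 by rewrite oppr_eq0.
have ngU z : z \in U -> ip (- g) z = 0 by move=> zU; rewrite ipNl gU // oppr0.
have wng : ip w (- g) = 0 by rewrite ipNr wg oppr0.
have [t2 t20 [S2 d2 q2]] := pencil_facet n0 Fx0 dU dim1 ng0 ngU wng.
have w1 : ip w (n + t1 *: g) = ip w n by rewrite ipDr ipZr wg mulr0 addr0.
have w2 : ip w (n + t2 *: - g) = ip w n by rewrite ipDr ipZr wng mulr0 addr0.
have u1 : n + t1 *: g != 0 by apply/eqP => e; move: w1; rewrite e ip0r; lra.
have u2 : n + t2 *: - g != 0 by apply/eqP => e; move: w2; rewrite e ip0r; lra.
have ne : F (n + t2 *: - g) != F (n + t1 *: g).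
  (* A common facet would make the two normals proportional, and equal since w takes the same value
     on both, but they differ by a nonzero multiple of g. *)
  apply/eqP => e.
  have [|t t0 vt] := facet_normal full d1 u1 u2; first by rewrite e.
  have t_1 : t = 1.
    apply: (@mulIf _ (ip w n)); first by rewrite gt_eqF.
    by rewrite mul1r -[in LHS]w1 -ipZr -vt w2.
  move: vt; rewrite t_1 scale1r => /addrI/eqP; rewrite -subr_eq0 scalerN -opprD -scalerDl.
  by rewrite oppr_eq0 scaler_eq0 (negbTE g0) orbF gt_eqF // addr_gt0.
have only H : H \in FF -> fdim H = 2%N -> F n `<=` H ->
    H = F (n + t1 *: g) \/ H = F (n + t2 *: - g).
  move=> /mem_faces[v v0 ->] dH nv.
  have wv : 0 < ip w v by apply: (center_gt0 full) => //; exact: nv.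
  (* With this factor v - al n is orthogonal to w as well as to the edge, hence a multiple of g. *)
  pose al := ip w v / ip w n.
  have al0 : 0 < al by rewrite divr_gt0.
  have [|b vb] := @orth_unique R U2 g (v - al *: n) dU2 g0 gU2.
    move=> z /memv_addP[z1 z1U [_ /vlineP[k ->] ->]].
    rewrite ipDr ipZr !ipBl !ipZl (supp_face_orth dU nv z1U) (nU z1 z1U).
    by rewrite !(ipC _ w) /al divfK ?gt_eqF // subrr !mulr0 subrr addr0.
  have vE : v = al *: (n + (b / al) *: g).
    by rewrite scalerDr scalerA mulrCA divff ?gt_eqF // mulr1 -vb addrC subrK.
  have FE : F v = F (n + (b / al) *: g) by rewrite {1}vE supp_faceZ.
  have [b0|b0] := lerP 0 (b / al).
    by left; rewrite FE (q1 (b / al)) // -FE.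
  have E : (b / al) *: g = (- (b / al)) *: - g by rewrite scaleNr scalerN opprK.
  right; rewrite FE E (q2 (- (b / al))) // -?E -?FE //.
  by rewrite oppr_ge0 ltW.
rewrite -big_filter (perm_big [:: F (n + t1 *: g); F (n + t2 *: - g)]) /=.
  by rewrite !big_cons big_nil.
apply: uniq_perm; first by rewrite filter_uniq // fset_uniq.
  by rewrite /= inE eq_sym ne.
move=> H; rewrite mem_filter !inE; apply/andP/orP.
  move=> [/andP[/eqP d /asboolP nH] HFF].
  by case: (only H HFF d nH) => ->; rewrite eqxx; [left|right].
by case=> /eqP->; split; rewrite ?mem_FF // ?d1 ?d2 eqxx /=; exact/asboolP.
Qed.

(** The generators of the face lie on a line with direction [d], and those extreme for [d] are the
    endpoints. *)
Lemma edge_segment n : fdim (F n) = 1%N ->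
  exists a b, F n = conv_hull [set a; b].
Proof.
move=> dF; have [U dU eU] := supp_face_direction full n.
have [s' Fs'] : exists s', F n = hull s' by eexists; exact: supp_face_hull.
have s'0 : s' != [::].
  by apply: hull_nonempty; rewrite -Fs'; have [x _ ?] := supp_face_nonempty n (P_nonempty full); exists x.
pose d := vpick U.
have d0 : d != 0 by rewrite vpick0 -dimv_eq0 eU dF.
have /eqP Ud : <[d]>%VS == U by rewrite eqEdim -memvE memv_pick dim_vline d0 eU dF.
have dd : ip d d != 0 by rewrite ip_eq0.
have [b bs mb] := seq_max (ip d) s'0.
have [a as_ ma] := seq_max (fun x => - ip d x) s'0.
exists a, b; rewrite Fs'; apply/seteqP; split; last first.
  by apply: conv_hullS => x /= [->|->].
apply: conv_hull_min; first exact: cvx_conv_hull.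
move=> y /= ys; have := mb y ys; have := ma y ys; rewrite lerN2 => ay yb.
have FU x : x \in s' -> exists k : R, x = a + k *: d.
  move=> xs; have : x - a \in U by apply: direction_sub dU _ _; rewrite Fs'; exact: mem_hull.
  by rewrite -Ud => /vlineP[k xk]; exists k; rewrite -xk addrC subrK.
have [k yk] := FU y ys; have [l bl] := FU b bs.
have ddp : 0 < ip d d by rewrite lt_neqAle eq_sym dd ip_ge0.
have k0 : 0 <= k by move: ay; rewrite yk ipDr ipZr; nra.
have kl : k <= l by move: yb; rewrite yk bl !ipDr !ipZr; nra.
have [l0|l0] := eqVneq l 0.
  have -> : y = a by rewrite yk (_ : k = 0) ?scale0r ?addr0 //; lra.
  by apply: sub_conv_hull; left.
have lp : 0 < l by rewrite lt_neqAle eq_sym l0 (le_trans k0).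
have -> : y = (k / l) *: b + (1 - k / l) *: a.
  rewrite bl scalerDr scalerA divfK // scalerBl scale1r addrC.
  by rewrite addrA subrK.
apply: cvx_conv_hull; [by apply: sub_conv_hull; right|by apply: sub_conv_hull; left|].
by rewrite divr_ge0 ?(ltW lp) //= ler_pdivrMr // mul1r.
Qed.

Lemma vertex_singleton n : fdim (F n) = 0%N -> exists v, F n = [set v].
Proof.
move=> dF; have [U dU eU] := supp_face_direction full n.
have [v _ Fv] := supp_face_nonempty n (P_nonempty full); exists v.
apply/seteqP; split=> x /=; last by move=> ->.
move=> Fx; have := direction_sub dU Fx Fv.
have -> : U = 0%VS by apply/eqP; rewrite -dimv_eq0 eU dF.
by rewrite memv0 subr_eq0 => /eqP.
Qed.

End EdgeFacets.

(** * Counting *)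

Lemma sum_one_count (T : eqType) (r : seq T) (Q : pred T) :
  \sum_(x <- r | Q x) (1 : int) = (count Q r)%:Z.
Proof. by rewrite -sum1_count -natz natr_sum. Qed.

Lemma set2_eq (T : Type) (a b x y : T) : [set a; b] = [set x; y] ->
  (x = a /\ y = b) \/ (x = b /\ y = a).
Proof.
move=> e; have : [set a; b] x by rewrite e; left.
have : [set a; b] y by rewrite e; right.
have : [set x; y] a by rewrite -e; left.
have : [set x; y] b by rewrite -e; right.
by do 4 (case=> /= ?); subst; auto.
Qed.

(** Ordered pairs are grouped by the set they form; by symmetry and irreflexivity each set arises
    from exactly two. *)
Lemma card_unordered_pairs (T : choiceType) (A : set T) (r : T -> T -> Prop) :
  finite_set A -> (forall x y, A x -> A y -> r x y -> r y x) ->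
  (forall x, A x -> ~ r x x) ->
  \sum_(x <- fset_set A) \sum_(y <- fset_set A | `[< r x y >]) (1 : int) =
  2 * (Defs.card (unordered_pairs A r))%:Z.
Proof.
move=> fA rC rI; set L := fset_set A.
have LP x : x \in L <-> A x by rewrite in_fset_set // inE.
pose UP := fset_set (unordered_pairs A r).
have fU : finite_set (unordered_pairs A r).
  apply: (@sub_finite_set _ _ (image2 A A (fun x y => [set x; y]))).
    by move=> _ [x [y [Ax Ay _ _ ->]]]; exists x => //; exists y.
  exact: finite_image2.
have UPP p : p \in UP <-> unordered_pairs A r p by rewrite in_fset_set // inE.
pose LL := [seq (x, y) | x <- L, y <- L].
have LLP q : q \in LL <-> A q.1 /\ A q.2.
  split=> [/allpairsP[[x y] /= [/LP ? /LP ? ->]] //|[/LP q1 /LP q2]].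
  by apply/allpairsP; exists q; case: q q1 q2.
transitivity (\sum_(q <- LL | `[< r q.1 q.2 >]) (1 : int)).
  rewrite [RHS]big_mkcond big_allpairs /=; apply: eq_bigr => x _.
  by rewrite big_mkcond.
transitivity (\sum_(q <- LL | `[< r q.1 q.2 >])
    \sum_(p <- UP | p == [set q.1; q.2]) (1 : int)).
  rewrite big_seq_cond [RHS]big_seq_cond; apply: eq_bigr => -[x y].
  move=> /andP[/LLP[/= Ax Ay] /asboolP rxy].
  rewrite big_mkcond (bigD1_seq [set x; y]) ?fset_uniq //=; last first.
    apply/UPP; exists x, y; split=> // xy; apply: (rI x) => //; by rewrite {2}xy.
  by rewrite eqxx big1 ?addr0 // => p /negbTE->.
rewrite (exchange_big_dep xpredT) //= /Defs.card -/UP.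
rewrite -sum1_size -natz natr_sum big_distrr /= big_seq [RHS]big_seq.
apply: eq_bigr => p /UPP[a [b [Aa Ab ab rab ->]]]; rewrite mulr1.
rewrite -big_filter (perm_big [:: (a, b); (b, a)]) /=.
  by rewrite !big_cons big_nil.
apply: uniq_perm.
- by rewrite filter_uniq // allpairs_uniq ?fset_uniq // => -[? ?] [? ?].
- by rewrite /= inE xpair_eqE negb_and; apply/andP; split=> //; apply/orP; left; apply/eqP.
move=> [x y]; rewrite mem_filter !inE /=; apply/andP/orP.
  move=> [/andP[/asboolP _ /eqP e] _].
  by case: (set2_eq e) => -[-> ->]; rewrite eqxx; [left|right].
case=> /eqP[-> ->]; split; try (by apply/LLP).
  by apply/andP; split; [exact/asboolP|].
apply/andP; split; first by apply/asboolP; exact: rC.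
by apply/eqP; rewrite setUC.
Qed.

Section Counting.
Variables (R : realType) (s : seq 'rV[R]_3).
Hypothesis full : has_dim (hull s) 3.
Implicit Types (G H : set 'rV[R]_3) (u v g : 'rV[R]_3).
Local Notation P := (hull s).
Local Notation F := (supp_face P).
Local Notation FF := (fset_set (faces P)).
Local Notation opp := (opp_touch s).

Definition nb_faces (i : nat) (Q : pred (set 'rV[R]_3)) : int :=
  \sum_(H <- FF | (fdim H == i) && Q H) 1.

Lemma eq_nb_faces i (Q Q' : pred (set 'rV[R]_3)) :
  (forall H, H \in FF -> fdim H = i -> Q H = Q' H) -> nb_faces i Q = nb_faces i Q'.
Proof.
move=> QQ; rewrite /nb_faces big_seq_cond [RHS]big_seq_cond; apply: eq_bigl => H.
by case: (boolP (H \in FF)) => //= HF; case: eqP => //= d; exact: QQ.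
Qed.

Lemma le_nb_faces i (Q Q' : pred (set 'rV[R]_3)) :
  (forall H, Q H -> Q' H) -> nb_faces i Q <= nb_faces i Q'.
Proof.
move=> QQ; rewrite /nb_faces !sum_one_count lez_nat; apply: sub_count => H /andP[-> /QQ].
by [].
Qed.

Lemma nb_faces_gt0 i (Q : pred (set 'rV[R]_3)) G : G \in FF -> fdim G = i -> Q G ->
  1 <= nb_faces i Q.
Proof.
move=> GF d QG; rewrite /nb_faces sum_one_count lez_nat -has_count.
by apply/hasP; exists G; rewrite // d eqxx.
Qed.

Lemma nb_faces0 i (Q : pred (set 'rV[R]_3)) :
  (forall H, H \in FF -> fdim H = i -> Q H -> False) -> nb_faces i Q = 0.
Proof.
move=> h; rewrite (@eq_nb_faces _ _ pred0) => [|H HF d].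
  by rewrite /nb_faces big_pred0 // => H; rewrite andbF.
by apply/negP => /(h H HF d).
Qed.

Lemma sum_faces1 (V : zmodType) i (Q : pred (set 'rV[R]_3)) G (a : set 'rV[R]_3 -> V) :
  G \in FF -> fdim G = i ->
  (forall H, H \in FF -> fdim H = i -> Q H <-> H = G) ->
  \sum_(H <- FF | (fdim H == i) && Q H) a H = a G.
Proof.
move=> GF d h; rewrite big_mkcond (bigD1_seq G) ?fset_uniq //= d eqxx.
rewrite (_ : Q G) /=; last by apply/(h G GF d).
rewrite big_seq_cond big1 ?addr0 // => H /andP[HF HG].
by case: ifP => // /andP[/eqP dH /(h H HF dH) e]; rewrite e eqxx in HG.
Qed.

Lemma nb_faces1 i (Q : pred (set 'rV[R]_3)) G : G \in FF -> fdim G = i ->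
  (forall H, H \in FF -> fdim H = i -> Q H <-> H = G) -> nb_faces i Q = 1.
Proof. by move=> GF d h; rewrite /nb_faces (sum_faces1 (fun=> 1) GF d h). Qed.

Lemma sum_fsign (Q : pred (set 'rV[R]_3)) :
  \sum_(H <- FF | Q H) fsign H = nb_faces 0 Q - nb_faces 1 Q + nb_faces 2 Q.
Proof.
have E i : nb_faces i Q = \sum_(H <- FF) (if (fdim H == i) && Q H then 1 else 0).
  by rewrite /nb_faces big_mkcond.
rewrite !E big_mkcond -sumrB -big_split /= big_seq [RHS]big_seq.
apply: eq_bigr => H /mem_faces[u u0 ->]; have := fdim_le2 full u0.
rewrite /fsign; case: (fdim (F u)) => [|[|[|//]]] _; by case: (Q _).
Qed.

(** [face_count] at u = 0, where the support face is P itself and 1 - (-1)^3 = 2. *)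
Lemma euler_formula : nb_faces 0 xpredT - nb_faces 1 xpredT + nb_faces 2 xpredT = 2.
Proof.
rewrite -sum_fsign; have := face_count full 0; rewrite supp_face_full (fdim_full full).
rewrite (_ : 1 - _ = 2) // => <-; rewrite big_seq_cond [RHS]big_seq_cond.
apply: eq_bigl => H; case: (boolP (H \in FF)) => //= /mem_faces[u u0 ->].
by apply/esym/asboolP; split=> [x []//|]; exact: supp_face_proper.
Qed.

Definition nb_opp i j : int := \sum_(G <- FF | fdim G == i) nb_faces j (opp G).

Lemma nb_oppC i j : nb_opp i j = nb_opp j i.
Proof.
rewrite /nb_opp /nb_faces (exchange_big_dep (fun H => fdim H == j)) /=; last first.
  by move=> G H _ /andP[].
apply: eq_bigr => H dH; apply: eq_bigl => G; by rewrite dH opp_touchC.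
Qed.

Lemma nb_opp_euler i : nb_opp i 0 - nb_opp i 1 + nb_opp i 2 = nb_faces i xpredT.
Proof.
rewrite /nb_opp -sumrB -big_split /= big_seq_cond /nb_faces.
rewrite [RHS]big_seq_cond; apply: eq_big => [G|G /andP[/mem_faces GF _]].
  by rewrite andbT.
by rewrite -sum_fsign (opp_count full).
Qed.

(** The relations for vertices and edges eliminate the vertex-edge term, the one for facets the
    vertex-facet term, and Euler's formula replaces E - f2 by V - 2. *)
Lemma nb_opp_formula : nb_opp 0 0 - nb_opp 1 1 =
  2 * nb_faces 0 xpredT - 2 - 2 * nb_opp 2 1 + nb_opp 2 2.
Proof.
have := euler_formula; have := nb_opp_euler 0; have := nb_opp_euler 1.
have := nb_opp_euler 2; rewrite (nb_oppC 0 1) (nb_oppC 0 2) (nb_oppC 1 2).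
lra.
Qed.

End Counting.

(** * The quantities of the statement as face counts *)

Section Final.
Variables (R : realType) (s : seq 'rV[R]_3).
Hypothesis full : has_dim (hull s) 3.
Implicit Types (G H : set 'rV[R]_3) (u v g : 'rV[R]_3).
Local Notation P := (hull s).
Local Notation F := (supp_face P).
Local Notation FF := (fset_set (faces P)).
Local Notation opp := (opp_touch s).
Local Notation nbf := (nb_faces s).

Lemma face_mem d H : face P d H <-> H \in FF /\ fdim H = d.
Proof.
rewrite faceP; split=> [[HP hd]|[/mem_faces HP <-]].
  by split; [exact/mem_faces|exact: fdim_eq].
by split=> //; case: HP => u _ ->; exact: supp_face_has_dim.
Qed.

Lemma finite_face d : finite_set (face P d).
Proof.
by apply: sub_finite_set (finite_faces s) => H /faceP[].
Qed.

Lemma perm_face d : perm_eq (fset_set (face P d)) [seq H <- FF | fdim H == d].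
Proof.
apply: uniq_perm; rewrite ?filter_uniq ?fset_uniq // => H.
rewrite mem_filter in_fset_set; last exact: finite_face.
apply/idP/idP; rewrite inE; first by move=> /face_mem[-> ->]; rewrite eqxx.
by move=> /andP[/eqP d1 HF]; apply/face_mem.
Qed.

Lemma nb_faces_card d : (Defs.card (face P d))%:Z = nbf d xpredT.
Proof.
rewrite /Defs.card (perm_size (perm_face d)) size_filter /nb_faces sum_one_count.
by congr (_%:Z); apply: eq_count => H; rewrite andbT.
Qed.

Lemma finite_vertex : finite_set (vertex P).
Proof.
apply: (@sub_finite_set _ _ [set` s]); last by apply/finite_seqP; exists s.
move=> v /faceP[[u u0 e] _] /=.
have [x xs Fx] := supp_face_nonempty u (P_nonempty full).
by move: Fx; rewrite -e => /= <-.
Qed.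

(** Vertices are points in the statement but singleton faces in the counts. *)
Lemma perm_vertex :
  perm_eq [seq [set v] | v <- fset_set (vertex P)] [seq H <- FF | fdim H == 0%N].
Proof.
apply: uniq_perm; rewrite ?filter_uniq ?fset_uniq //.
  rewrite map_inj_uniq ?fset_uniq // => x y /(congr1 (fun A : set 'rV[R]_3 => A x)) /= e.
  by rewrite -e.
have VP v : v \in fset_set (vertex P) <-> vertex P v.
  by rewrite in_fset_set ?inE //; exact: finite_vertex.
move=> H; rewrite mem_filter; apply/mapP/andP => [[v /VP/face_mem[vF d] ->]|[/eqP d HF]].
  by rewrite vF d.
have /mem_faces[u u0 Hu] := HF; have [|v Hv] := @vertex_singleton _ _ full u.
  by rewrite -Hu.
exists v; last by rewrite Hu.
by apply/VP/face_mem; rewrite -Hv -Hu.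
Qed.

Lemma nb_vertices_faces : (nb_vertices P)%:Z = nbf 0 xpredT.
Proof.
rewrite /nb_vertices /Defs.card -(size_map (fun v => [set v])) (perm_size perm_vertex).
rewrite size_filter /nb_faces sum_one_count.
by congr (_%:Z); apply: eq_count => H; rewrite andbT.
Qed.

(** In [antipodal] the point x minimises u, so it lies in the support face of -u; hence the change
    of sign. *)
Lemma antipodal_opp x y : P x -> P y -> antipodal P x y <-> opp [set x] [set y].
Proof.
move=> Px Py; split=> [[_ _ [u [a [b [u0 ux uy h]]]]]|/asboolP[u [u0 xu yu]]].
  apply/asboolP; exists (- u); rewrite oppr_eq0 opprK; split=> // z /= ->; apply/supp_faceP.
    by split=> // t /h/andP[+ _]; rewrite -ux !ipNl lerN2.
  by split=> // t /h/andP[_]; rewrite -uy.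
split=> //; exists (- u), (ip (- u) x), (ip (- u) y); rewrite oppr_eq0; split=> // z Pz.
have /supp_faceP[_ mx] := xu x erefl; have /supp_faceP[_ my] := yu y erefl.
have xz : ip (- u) x <= ip (- u) z by rewrite !ipNl lerN2; exact: mx.
by apply/andP; split; [exact: xz|exact: my].
Qed.

Lemma antipodal_sym x y : antipodal P x y -> antipodal P y x.
Proof.
move=> [Px Py h]; apply/antipodal_opp => //; rewrite opp_touchC.
by apply/antipodal_opp.
Qed.

(** An average of two values reaches the maximum only if both do. *)
Lemma supp_face_midpoint u a b : P a -> P b -> F u (2^-1 *: (a + b)) -> F u a /\ F u b.
Proof.
move=> Pa Pb /supp_faceP[_ m].
have E : ip u (2^-1 *: (a + b)) = (ip u a + ip u b) / 2 by rewrite ipZr ipDr mulrC.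
have := m a Pa; have := m b Pb; rewrite E => ma mb.
split; apply/supp_faceP; split=> // y /m; rewrite E; lra.
Qed.

Lemma midpoint_sub (e : set 'rV[R]_3) m u : is_midpoint e m -> e `<=` P -> F u m -> e `<=` F u.
Proof.
move=> [a [b [-> ->]]] eP /supp_face_midpoint[].
- by apply: eP; apply: sub_conv_hull; left.
- by apply: eP; apply: sub_conv_hull; right.
move=> Fa Fb; apply: conv_hull_min; first by apply: cvx_supp_face; exact: cvx_conv_hull.
by move=> x /= [->|->].
Qed.

Lemma midpoint_mem (e : set 'rV[R]_3) m : is_midpoint e m -> e m.
Proof.
move=> [a [b [-> ->]]]; rewrite scalerDr.
have -> : 2^-1 *: b = (1 - 2^-1) *: b :> 'rV[R]_3 by congr (_ *: _); field.
by apply: cvx_conv_hull; [apply: sub_conv_hull; left|apply: sub_conv_hull; right|lra].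
Qed.

(** A support face contains the midpoint of an edge exactly when it contains the whole edge. *)
Lemma antipodal_midpoints_opp e f : edge P e -> edge P f ->
  antipodal_midpoints P e f <-> opp e f.
Proof.
move=> /face_mem[/mem_faces[ne ne0 eE] de] /face_mem[/mem_faces[nf nf0 fE] df].
have eP : e `<=` P by rewrite eE => x [].
have fP : f `<=` P by rewrite fE => x [].
split=> [[m [n [em fn /[dup] amn [Pm Pn _]]]]|/asboolP[u [u0 eu fu]]].
  move: amn => /(antipodal_opp Pm Pn)/asboolP[u [u0 mu nu]].
  apply/asboolP; exists u; split=> //.
    by apply: (midpoint_sub em eP); exact: mu.
  by apply: (midpoint_sub fn fP); exact: nu.
have [a [b ab]] : exists a b, e = conv_hull [set a; b].
  by rewrite eE; apply: (edge_segment full); rewrite -eE.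
have [c [d cd]] : exists c d, f = conv_hull [set c; d].
  by rewrite fE; apply: (edge_segment full); rewrite -fE.
have em : is_midpoint e (2^-1 *: (a + b)) by exists a, b.
have fm : is_midpoint f (2^-1 *: (c + d)) by exists c, d.
exists (2^-1 *: (a + b)), (2^-1 *: (c + d)); split=> //.
have em' := midpoint_mem em; have fm' := midpoint_mem fm.
apply/antipodal_opp; [exact: eP|exact: fP|].
by apply/asboolP; exists u; split=> // x /= ->; [exact: eu|exact: fu].
Qed.

(** On a point common to opposite support faces v is both maximal and minimal, so v would be
    constant on P. *)
Lemma opp_irrefl u : ~ opp (F u) (F u).
Proof.
move=> /asboolP[v [v0 uv uv']]; apply: (supp_face_proper full v0) => y Py.
have [x _ Fx] := supp_face_nonempty u (P_nonempty full).
have /supp_faceP[_ m1] := uv x Fx; have /supp_faceP[_ m2] := uv' x Fx.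
apply/supp_faceP; split=> // z /m1 zx; have := m2 y Py; rewrite !ipNl; lra.
Qed.

Lemma nb_antipodal_vertices_opp : 2 * (nb_antipodal_vertices P)%:Z = nb_opp s 0 0.
Proof.
rewrite /nb_antipodal_vertices -card_unordered_pairs; first last.
- move=> x /faceP[[u u0 e] _] xx; have [Px _ _] := xx; move: xx => /(antipodal_opp Px Px).
  by rewrite e; exact: opp_irrefl.
- by move=> x y _ _; exact: antipodal_sym.
- exact: finite_vertex.
rewrite /nb_opp -[RHS]big_filter -[RHS](perm_big _ perm_vertex) /= big_map.
rewrite big_seq [RHS]big_seq; apply: eq_bigr => x.
rewrite in_fset_set ?inE; last exact: finite_vertex.
move=> xv; rewrite /nb_faces -[RHS]big_filter_cond -[RHS](perm_big _ perm_vertex) /= big_map.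
rewrite big_seq_cond [RHS]big_seq_cond; apply: eq_bigl => y.
case: (boolP (y \in _)) => //=; rewrite in_fset_set ?inE; last exact: finite_vertex.
have vP z : vertex P z -> P z.
  by move=> /faceP[[u u0 e] _]; have : [set z] z by []; rewrite e => -[].
move=> yv; apply/asboolP/idP => h; apply/antipodal_opp => //; exact: vP.
Qed.

Lemma nb_antipodal_edges_opp : 2 * (nb_antipodal_edges P)%:Z = nb_opp s 1 1.
Proof.
rewrite /nb_antipodal_edges -card_unordered_pairs; first last.
- move=> e eE /(antipodal_midpoints_opp eE eE); have /faceP[[u u0 ->] _] := eE.
  exact: opp_irrefl.
- move=> e f eE fE /(antipodal_midpoints_opp eE fE) h.
  by apply/antipodal_midpoints_opp; rewrite // opp_touchC.
- exact: finite_face.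
rewrite /nb_opp -[RHS]big_filter -[RHS](perm_big _ (perm_face 1)) /=.
rewrite big_seq [RHS]big_seq; apply: eq_bigr => e.
rewrite in_fset_set ?inE; last exact: finite_face.
move=> eE; rewrite /nb_faces -[RHS]big_filter_cond -[RHS](perm_big _ (perm_face 1)) /=.
rewrite big_seq_cond [RHS]big_seq_cond; apply: eq_bigl => f.
case: (boolP (f \in _)) => //=; rewrite in_fset_set ?inE; last exact: finite_face.
by move=> fE; apply/asboolP/idP => h; apply/antipodal_midpoints_opp.
Qed.

Lemma defect_opp : 2 * defect P = 2 * nb_opp s 2 1 - nb_opp s 2 2.
Proof.
have := nb_opp_formula full; rewrite -nb_antipodal_vertices_opp -nb_antipodal_edges_opp.
rewrite -nb_vertices_faces /defect; lra.
Qed.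

End Final.

(** * Faces opposite to facets, and the terms of the two sums *)

Section Opposite.
Variables (R : realType) (s : seq 'rV[R]_3).
Hypothesis full : has_dim (hull s) 3.
Implicit Types (G H : set 'rV[R]_3) (u v g : 'rV[R]_3).
Local Notation P := (hull s).
Local Notation F := (supp_face P).
Local Notation FF := (fset_set (faces P)).
Local Notation opp := (opp_touch s).
Local Notation nbf := (nb_faces s).
Local Notation star := (opp_face P).

Definition below (H : set 'rV[R]_3) : pred (set 'rV[R]_3) := fun G => `[< G `<=` H >].

(** A rescaled normal of the facet shows that [xget] does not return its default. *)
Lemma opp_faceP H : H \in FF -> fdim H = 2%N ->
  exists2 n, n != 0 & H = F n /\ star H = F (- n).
Proof.
move=> HF d; have /faceP[] : face P 2 H by apply/face_mem.
move=> [u u0 Hu] _; have [t t0 st] := normalize_sphere u0.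
have [sn Hn] : [set n | sphere n /\ H = supp_face P n] (outward_normal P H).
  by apply: xgetPex; exists (t *: u); split; rewrite // supp_faceZ.
by exists (outward_normal P H) => //; exact: sphere_neq0.
Qed.

Lemma opp_below H : H \in FF -> fdim H = 2%N -> opp H =1 below (star H).
Proof.
move=> HF d G; have [n n0 [Hn Sn]] := opp_faceP HF d.
by rewrite opp_touchC Hn opp_touch_facet -?Hn // -Sn.
Qed.

Lemma nb_below_gt u j : (fdim (F u) < j)%N -> nbf j (below (F u)) = 0.
Proof.
move=> dj; apply: nb_faces0 => H /mem_faces[v v0 ->] d /asboolP vu.
by have := subface_dim full (erefl (F u)) vu; rewrite d leqNgt dj.
Qed.

Lemma below_eq u H : H \in FF -> fdim H = fdim (F u) -> below (F u) H <-> H = F u.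
Proof.
move=> /mem_faces[v v0 ->] d; split=> [/asboolP vu|->]; last exact/asboolP.
exact: (subface_eq full).
Qed.

Lemma nb_below_eq u : u != 0 -> nbf (fdim (F u)) (below (F u)) = 1.
Proof.
move=> u0; apply: (@nb_faces1 _ _ _ _ (F u)) => //; first exact: mem_FF.
by move=> H HF d; apply: below_eq.
Qed.

Lemma face_euler u : u != 0 ->
  nbf 0 (below (F u)) - nbf 1 (below (F u)) + nbf 2 (below (F u)) = 1.
Proof. by move=> u0; rewrite -(sum_fsign full) -[RHS](face_count_closed full u0). Qed.

Lemma edge_vertices u : u != 0 -> fdim (F u) = 1%N -> nbf 0 (below (F u)) = 2.
Proof.
move=> u0 d; have := face_euler u0; rewrite (@nb_below_gt u 2) ?d //.
have := nb_below_eq u0; rewrite d; lra.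
Qed.

(** By Euler's relation the facet has as many vertices as edges, so one edge suffices: its two ends
    force a second. A tilt inside the facet finds an edge, or a vertex, and then the equality
    provides an edge. *)
Lemma facet_edges_ge2 u : u != 0 -> fdim (F u) = 2%N -> 2 <= nbf 1 (below (F u)).
Proof.
move=> u0 d2; have := face_euler u0; have := nb_below_eq u0; rewrite d2 => -> VE.
have {}VE : nbf 0 (below (F u)) = nbf 1 (below (F u)) by move: VE; lra.
suff : exists2 v, v != 0 & F v `<=` F u /\ fdim (F v) = 1%N.
  move=> [v v0 [vu dv]]; have := edge_vertices v0 dv.
  have : nbf 0 (below (F v)) <= nbf 0 (below (F u)).
    apply: le_nb_faces => H /asboolP Hv; apply/asboolP; exact: subset_trans Hv vu.
  by rewrite VE => le2 e2; rewrite e2 in le2.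
have [U dU eU] := supp_face_direction full u.
have c0 : vpick U != 0 by rewrite vpick0 -dimv_eq0 eU d2.
have [e e0 tilt] := supp_face_tilt u (vpick U) (P_nonempty full).
set v := u + e *: vpick U in tilt.
have vu : F v `<=` F u by rewrite tilt => x [].
have nuv : ~ (F u `<=` F v).
  rewrite tilt => h; move/eqP: c0; apply; apply/eqP; rewrite -ip_eq0; apply/eqP.
  apply: (direction_orth dU) (memv_pick U).
  move=> x y /h/supp_faceP[Fx mx] /h/supp_faceP[Fy my].
  by apply/eqP; rewrite eq_le mx ?my.
have v0 : v != 0.
  by apply/eqP => v0; apply: nuv; rewrite v0 supp_face_full => x [].
have : (fdim (F v) < fdim (F u))%N by apply: (proper_subface_dim full).
rewrite d2 ltnS leq_eqVlt => /orP[/eqP d1|]; first by exists v.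
rewrite ltnS leqn0 => /eqP d0.
have : 1 <= nbf 0 (below (F u)).
  by apply: (@nb_faces_gt0 _ _ _ _ (F v)) => //; [exact: mem_FF|exact/asboolP].
rewrite VE /nb_faces sum_one_count lez_nat -has_count => /hasP[H /mem_faces[x x0 ->]].
by move=> /andP[/eqP dx /asboolP xu]; exists x.
Qed.

(** Double counting of incidences, with two facets at each edge by [edge_facets]. *)
Lemma edge_facet_incidences : \sum_(H <- FF | fdim H == 2%N) nbf 1 (below H) = 2 * nbf 1 xpredT.
Proof.
rewrite /nb_faces (exchange_big_dep (fun G => fdim G == 1%N)) /=; last first.
  by move=> H G _ /andP[].
rewrite big_distrr /= big_seq_cond [RHS]big_seq_cond; apply: eq_big => [G|G].
  by rewrite andbT.
move=> /andP[/mem_faces[u u0 ->] /eqP d]; rewrite mulr1 -[RHS](edge_facets full u0 d).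
by apply: eq_bigl => H; rewrite d.
Qed.

Lemma opp_face_face H : H \in FF -> fdim H = 2%N -> star H \in FF.
Proof.
move=> HF d; have [n n0 [_ ->]] := opp_faceP HF d; by apply: mem_FF; rewrite oppr_eq0.
Qed.

Lemma opp_counts H : H \in FF -> fdim H = 2%N ->
  [\/ [/\ fdim (star H) = 0%N, nbf 1 (opp H) = 0 & nbf 2 (opp H) = 0],
      [/\ fdim (star H) = 1%N, nbf 1 (opp H) = 1 & nbf 2 (opp H) = 0]
    | [/\ fdim (star H) = 2%N, 2 <= nbf 1 (opp H), nbf 2 (opp H) = 1
        & nbf 1 (opp H) = nbf 1 (below (star H))]].
Proof.
move=> HF d; have E i : nbf i (opp H) = nbf i (below (star H)).
  by apply: eq_nb_faces => G _ _; rewrite (opp_below HF d).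
rewrite !E; have /mem_faces[u u0 ->] := opp_face_face HF d.
have := fdim_le2 full u0; have := nb_below_eq u0; have := @facet_edges_ge2 u u0.
have := @nb_below_gt u.
case: (fdim (F u)) => [|[|[|//]]] gt ge2 e1 _; [apply: Or31|apply: Or32|apply: Or33];
  by split=> //; [rewrite gt..|exact: ge2] || (split=> //; rewrite ?gt ?ge2).
Qed.

(** The share of H in 2 M - 2 delta. A facet whose opposite face is a facet gets 0, because such
    differences cancel in total by [sum_paired], though not one by one. *)
Definition gap H : int :=
  if fdim (star H) == 2%N then 0 else 2 * nbf 1 (below H) - 1 - 2 * nbf 1 (opp H).

(** With two edges in H the value is at least 4 - 1 - 2 = 1 when the opposite face is an edge, and 3
    when it is a vertex. *)
Lemma gap_ge H : H \in FF -> fdim H = 2%N -> fdim (star H) != 2%N -> 1 <= gap H.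
Proof.
move=> HF d; rewrite /gap; have /mem_faces[u u0 eH] := HF.
have : 2 <= nbf 1 (below H) by rewrite eH; apply: facet_edges_ge2; rewrite -?eH.
move: (nbf 1 (below H)) => x x2.
by case: (opp_counts HF d) => [[-> -> _]|[-> -> _]|[-> _ _ _]] //= _; clear -x2; lra.
Qed.

(** Passing to the opposite face permutes the facets whose opposite face is a facet. The reindexing
    is done by exchanging a double sum over opposite pairs of facets, a symmetric relation. *)
Lemma sum_paired :
  \sum_(H <- FF | fdim H == 2%N) (if fdim (star H) == 2%N then 2 * nbf 1 (opp H) - 1 else 0) =
  \sum_(H <- FF | fdim H == 2%N) (if fdim (star H) == 2%N then 2 * nbf 1 (below H) - 1 else 0).
Proof.
pose h G : int := 2 * nbf 1 (below G) - 1.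
transitivity (\sum_(H <- FF | fdim H == 2%N) \sum_(G <- FF | (fdim G == 2%N) && opp H G) h G).
  rewrite big_seq_cond [RHS]big_seq_cond; apply: eq_bigr => H /andP[HF /eqP d].
  have SF := opp_face_face HF d; have SP := opp_below HF d.
  case: (opp_counts HF d) => -[dS e1 e2]; rewrite dS /=.
  - rewrite big_seq_cond big1 // => G /andP[GF /andP[/eqP dG oG]].
    by have := nb_faces_gt0 GF dG oG; rewrite e2.
  - rewrite big_seq_cond big1 // => G /andP[GF /andP[/eqP dG oG]].
    by have := nb_faces_gt0 GF dG oG; rewrite e2.
  move=> e3; rewrite (@sum_faces1 _ _ _ _ _ (star H) h) // ?e3 // => G GF dG.
  rewrite SP; have /mem_faces[v v0 Sv] := SF; rewrite Sv; apply: below_eq => //.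
  by rewrite dG -Sv.
rewrite (exchange_big_dep (fun G => fdim G == 2%N)) /=; last by move=> H G _ /andP[].
rewrite big_seq_cond [RHS]big_seq_cond; apply: eq_bigr => G /andP[GF /eqP d].
have -> : \sum_(H <- FF | (fdim H == 2%N) && ((fdim G == 2%N) && opp H G)) h G = nbf 2 (opp G) * h G.
  rewrite /nb_faces big_distrl /=; apply: eq_big => [H|H _]; last by rewrite mul1r.
  by rewrite d opp_touchC.
by case: (opp_counts GF d) => -[-> _ ->] //= *; rewrite ?mul0r ?mul1r.
Qed.

Lemma defect_gap :
  4 * nbf 1 xpredT - nbf 2 xpredT - 2 * defect P = \sum_(H <- FF | fdim H == 2%N) gap H.
Proof.
rewrite (defect_opp full) -[4]/(2 * 2 : int) -mulrA -edge_facet_incidences.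
have -> : nbf 2 xpredT = \sum_(H <- FF | fdim H == 2%N) (1 : int).
  by apply: eq_bigl => H; rewrite andbT.
rewrite /nb_opp !big_distrr /= -!sumrB.
have : \sum_(H <- FF | fdim H == 2%N) (2 * nbf 1 (below H) - 1 - (2 * nbf 1 (opp H) - nbf 2 (opp H)))
  = \sum_(H <- FF | fdim H == 2%N) (gap H
     + (if fdim (star H) == 2%N then 2 * nbf 1 (below H) - 1 else 0)
     - (if fdim (star H) == 2%N then 2 * nbf 1 (opp H) - 1 else 0)).
  rewrite big_seq_cond [RHS]big_seq_cond; apply: eq_bigr => H /andP[HF /eqP d].
  rewrite /gap; case: (opp_counts HF d) => [[-> -> ->]|[-> -> ->]|[-> _ -> _]] /=;
    move: (nbf 1 (below H)) => x; try move: (nbf 1 (opp H)) => y; clear HF d; lra.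
by move=> ->; rewrite sumrB big_split /= sum_paired addrK.
Qed.

Lemma defect_sum :
  2 * defect P = \sum_(H <- FF | fdim H == 2%N) (2 * nbf 1 (opp H) - nbf 2 (opp H)).
Proof. by rewrite (defect_opp full) /nb_opp big_distrr /= -sumrB. Qed.

(** The weight is 0, 2 or at least 3 as the opposite face is a vertex, an edge or a facet. *)
Lemma opp_weight_ge0 H : H \in FF -> fdim H = 2%N ->
  0 <= 2 * nbf 1 (opp H) - nbf 2 (opp H) ?= iff (fdim (star H) == 0%N).
Proof.
move=> HF d; apply/leifP.
case: (opp_counts HF d) => [[-> -> ->]|[-> -> ->]|[-> x2 -> _]] //=.
by move: (nbf 1 _) x2 => x x2; clear -x2; lra.
Qed.

Lemma gap_ge0 H : H \in FF -> fdim H = 2%N -> 0 <= gap H ?= iff (fdim (star H) == 2%N).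
Proof.
move=> HF d; apply/leifP; case: ifP => [e|/negbT e]; first by rewrite /gap e.
by apply: lt_le_trans (gap_ge HF d e).
Qed.

Lemma sum_leif0 (r : seq (set 'rV[R]_3)) (Q C : pred (set 'rV[R]_3)) (a : set 'rV[R]_3 -> int) :
  (forall H, H \in r -> Q H -> 0 <= a H ?= iff C H) ->
  0 <= \sum_(H <- r | Q H) a H /\
  (\sum_(H <- r | Q H) a H = 0 <-> forall H, H \in r -> Q H -> C H).
Proof.
move=> h; have ge0 H : (H \in r) && Q H -> 0 <= a H by move=> /andP[Hr QH]; have [] := h H Hr QH.
rewrite big_seq_cond; split; first exact: sumr_ge0.
split=> [/eqP|hC].
  rewrite psumr_eq0 // => /allP S0 H Hr QH; have := S0 H Hr; rewrite Hr QH /=.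
  by have [_ <-] := h H Hr QH; rewrite eq_sym.
apply: big1 => H /andP[Hr QH]; apply/eqP; rewrite eq_sym.
by have [_ ->] := h H Hr QH; exact: hC.
Qed.

End Opposite.

(** * The two bounds on the defect and their equality cases *)

Theorem corollary3p9 (R : realType) (P : set 'rV[R]_3)
    (hP : convex_polyhedron P) :
  [/\ 0 <= defect P,
      (defect P)%:~R <= max_defect P,
      defect P = 0 <->
        (forall F : set 'rV[R]_3, facet P F ->
           exists2 v : 'rV[R]_3, vertex P v & opp_face P F = [set v])
    & (defect P)%:~R = max_defect P <-> facet_paired P].
Proof.
have [[S /finite_seqP[s ->] ->] full] := hP; rewrite -/(hull s) in full *.
have [S0 E0] := sum_leif0 (fun H HF d => opp_weight_ge0 full HF (eqP d)).
have [S1 E1] := sum_leif0 (fun H HF d => gap_ge0 full HF (eqP d)).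
rewrite -(defect_sum full) in S0 E0; rewrite -(defect_gap full) in S1 E1.
rewrite -!(nb_faces_card full) -/(nb_edges _) -/(nb_facets _) in S1 E1.
(* By [defect_gap] the halved integer is the sum of the gaps, so the upper bound and its equality
   case follow from [S1] and [E1]. *)
have bound : (defect (hull s))%:~R = max_defect (hull s) -
    (4 * (nb_edges (hull s))%:Z - (nb_facets (hull s))%:Z - 2 * defect (hull s))%:~R / 2.
  by rewrite /max_defect !rmorphB !rmorphM /= -!pmulrn; clear; lra.
split.
- by clear -S0; lra.
- by rewrite bound gerBl divr_ge0 // ler0z.
- split=> [d0 H /(face_mem full)[HF d]|h].
    have Sf := opp_face_face full HF d.
    have /eqP dS : fdim (opp_face (hull s) H) == 0%N.
      by apply: (E0.1 _ H HF); rewrite ?d0 ?d.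
    have /mem_faces[u u0 Su] := Sf.
    have [|v Sv] := @vertex_singleton _ _ full u; first by rewrite -Su.
    by exists v; rewrite ?Su //; apply/(face_mem full); rewrite -Sv -Su.
  suff : 2 * defect (hull s) = 0 by clear; lra.
  apply/E0 => H HF /eqP d; have [|v vv ->] := h H; first exact/(face_mem full).
  by have /(face_mem full)[_ ->] := vv.
- split=> [b H /(face_mem full)[HF d]|h].
    apply/(face_mem full); split; first exact: opp_face_face.
    apply/eqP; apply: (E1.1 _ H HF); last by rewrite d.
    move: bound; rewrite b => /eqP; rewrite -subr_eq0 opprB addrCA subrr addr0.
    by rewrite mulf_eq0 invr_eq0 orbF intr_eq0 => /eqP.
  rewrite bound (E1.2 _) ?mul0r ?subr0 // => H HF /eqP d.
  have /h/(face_mem full)[_ ->] // : facet (hull s) H by apply/(face_mem full).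
Qed.
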